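(* Let $L$ be a countable relational language. Let $\mu$ be a properly ergodic structure on $\mathrm{Str}_L$, $F$ a countable fragment of $\mathcal{L}_{\omega_1,\omega}$, and $\chi(\overline{x})$ a formula in $F$ such that $\mu(\chi(\overline{x}))>0$ and $\forall\overline{x}\,\big(\chi(\overline{x})\rightarrow\bigwedge_{i\neq j}x_i\neq x_j\big)\in\mathrm{Th}_F(\mu)$. Suppose that $\mu(p)=0$ for every $F$-type $p(\overline{x})$ containing $\chi(\overline{x})$. Then $\mu$ assigns measure $1$ to the set of $\chi$-rooted models (in $\mathrm{Str}_L$) of $\mathrm{Th}_F(\mu)$.
   Context: $\mathrm{Str}_L$ is the space of $L$-structures with domain $\mathbb{N}$, with the topology generated by the sets $\{M : M\models R(\overline{a})\}$ and $\{M: M\models\lnot R(\overline{a})\}$ ($R\in L$, $\overline a$ a tuple from $\mathbb{N}$). The logic action of $\mathrm{Sym}(\mathbb{N})$ on $\mathrm{Str}_L$ is by permuting the underlying set; its orbits are the isomorphism classes in $\mathrm{Str}_L$. A Borel probability measure $\mu$ on $\mathrm{Str}_L$ is invariant if $\mu(\sigma[X])=\mu(X)$ for all Borel $X$ and $\sigma\in\mathrm{Sym}(\mathbb{N})$. An invariant $\mu$ is ergodic if every Borel $X$ with $\mu(X\triangle\sigma[X])=0$ for all $\sigma\in \mathrm{Sym}(\mathbb{N})$ has $\mu(X)\in\{0,1\}$. An ergodic structure is an ergodic invariant probability measure on $\mathrm{Str}_L$; it is properly ergodic if it assigns measure $0$ to every orbit of the logic action. $\mathcal{L}_{\omega_1,\omega}$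 extends first-order logic by conjunctions and disjunctions of countable families of formulas with a common finite set of free variables; all variables come from a fixed countable supply. A fragment is a set of $\mathcal{L}_{\omega_1,\omega}$-formulas containing all atomic formulas and closed under subformulas, finite Boolean combinations, quantification, and substitution of free variables. $\mathrm{Th}_F(\mu)$ is the set of sentences $\varphi\in F$ with $\mu(\{M\in\mathrm{Str}_L : M\models\varphi\})=1$. An $F$-type is a set $p(\overline{x})=\{\psi(\overline{x})\in F: M\models\psi(\overline{a})\}$ for some structure $M$ and tuple $\overline{a}$ from $M$ (then $\overline{a}$ realizes $p$ in $M$). For an $\mathcal{L}_{\omega_1,\omega}$-formula $\varphi(\overline{x})$, $\mu(\varphi(\overline{x}))$ denotes $\mu(\{M\in\mathrm{Str}_L: M\models\varphi(\overline{a})\})$ for any tuple $\overline{a}$ of distinct elements of $\mathbb{N}$ (independent of $\overline{a}$ by invariance). For an $F$-type $p(\overline{x})$, $\mu(p)$ denotes $\mu(\bigwedge_{\varphi\in p}\varphi(\overline{x}))$. For an $F$-type $p$ in variables $x_0,\dots,x_{n-1}$ containing $x_i\ne x_j$ for all $i\neq j$ and realized in $M$, an element $a\in M$ is a root of $p$ in $M$ if $a$ is an entry of every tuple realizing $p$ in $M$. A model $M$ of an $F$-theory $T$ containing $\forall\overline{x}\,(\chi(\overline{x})\rightarrow\bigwedge_{i\ne j}x_i\neq x_j)$ is $\chi$-rooted if every $F$-type $p(\overline{x})$ which contains $\chi$ and is realized in $M$ has a root in $M$. (The set of $\chi$-rooted models of $T$ in $\mathrm{Str}_L$ is Borel.)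 *)

(* Defs.v *)
From HB Require Import structures.
From mathcomp Require Import all_boot all_order all_algebra.
From mathcomp Require Import all_classical all_reals topology measure.

Set Implicit Arguments.
Unset Strict Implicit.
Unset Printing Implicit Defensive.

Local Open Scope classical_set_scope.

Record language := Language { rsym : countType; arity : rsym -> nat }.

Definition structure (L : language) (T : Type) : Type :=
  forall R : rsym L, (arity R).-tuple T -> Prop.

(* Variables are natural numbers. A nonempty countable family is a
   sequence indexed by [nat], possibly with repetitions; the empty conjunction and
   disjunction are [fTrue] and [fFalse]. *)
Inductive formula (L : language) : Type :=
| fTrue
| fFalse
| fRel (R : rsym L) of (arity R).-tuple nat
| fEq of nat & nat
| fNot of formula L
| fAnd of formula L & formula L
| fOr of formula L & formula L
| fAll of nat & formula L
| fEx of nat & formula L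
| fBigAnd of (nat -> formula L)
| fBigOr of (nat -> formula L).

Arguments fTrue {L}.
Arguments fFalse {L}.
Arguments fRel {L} R _.
Arguments fEq {L} _ _.

Definition fImp (L : language) (phi psi : formula L) := fOr (fNot phi) psi.

Fixpoint free_vars (L : language) (phi : formula L) : set nat :=
  match phi with
  | fTrue | fFalse => set0
  | fRel _ t => [set` t]
  | fEq i j => [set i; j]
  | fNot psi => free_vars psi
  | fAnd psi1 psi2 | fOr psi1 psi2 => free_vars psi1 `|` free_vars psi2
  | fAll i psi | fEx i psi => free_vars psi `\ i
  | fBigAnd f | fBigOr f => \bigcup_k free_vars (f k)
  end.

(* The formulas of L_{omega_1,omega}: the members of each countable family have
   their free variables in a common finite set. *)
Fixpoint well_formed (L : language) (phi : formula L) : Prop :=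
  match phi with
  | fTrue | fFalse | fRel _ _ | fEq _ _ => True
  | fNot psi | fAll _ psi | fEx _ psi => well_formed psi
  | fAnd psi1 psi2 | fOr psi1 psi2 => well_formed psi1 /\ well_formed psi2
  | fBigAnd f | fBigOr f =>
      finite_set (\bigcup_k free_vars (f k)) /\ forall k, well_formed (f k)
  end.

Definition update (T : Type) (v : nat -> T) (i : nat) (c : T) : nat -> T :=
  fun j => if j == i then c else v j.

Fixpoint sat (L : language) (T : Type) (M : structure L T) (v : nat -> T)
    (phi : formula L) : Prop :=
  match phi with
  | fTrue => True
  | fFalse => False
  | fRel R t => M R (map_tuple v t)
  | fEq i j => v i = v j
  | fNot psi => ~ sat M v psi
  | fAnd psi1 psi2 => sat M v psi1 /\ sat M v psi2
  | fOr psi1 psi2 => sat M v psi1 \/ sat M v psi2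
  | fAll i psi => forall c : T, sat M (update v i c) psi
  | fEx i psi => exists c : T, sat M (update v i c) psi
  | fBigAnd f => forall k, sat M v (f k)
  | fBigOr f => exists k, sat M v (f k)
  end.

(* [M |= phi(a)] for a formula [phi(x)] in the distinct variables [x]; the
   default value [point] is irrelevant when the free variables of [phi] are
   among [x]. Pointed types serve as nonempty domains. *)
Definition sat_at (L : language) (T : pointedType) (M : structure L T) (n : nat)
    (x : n.-tuple nat) (a : n.-tuple T) (phi : formula L) : Prop :=
  sat M (fun i => nth point a (index i x)) phi.

Definition sentence (L : language) (phi : formula L) : Prop :=
  free_vars phi = set0.

Definition models (L : language) (T : Type) (M : structure L T)
    (phi : formula L) : Prop :=
  forall v : nat -> T, sat M v phi.

(* Simultaneous substitution of the variable [s i] for each free variable [i].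
   It is the intended one when it captures no variable, i.e. when [s] is free
   for [phi]. *)
Fixpoint subst (L : language) (s : nat -> nat) (phi : formula L) : formula L :=
  match phi with
  | fTrue => fTrue
  | fFalse => fFalse
  | fRel R t => fRel R (map_tuple s t)
  | fEq i j => fEq (s i) (s j)
  | fNot psi => fNot (subst s psi)
  | fAnd psi1 psi2 => fAnd (subst s psi1) (subst s psi2)
  | fOr psi1 psi2 => fOr (subst s psi1) (subst s psi2)
  | fAll i psi => fAll i (subst (update s i i) psi)
  | fEx i psi => fEx i (subst (update s i i) psi)
  | fBigAnd f => fBigAnd (fun k => subst s (f k))
  | fBigOr f => fBigOr (fun k => subst s (f k))
  end.

Fixpoint free_for (L : language) (s : nat -> nat) (phi : formula L) : Prop :=
  match phi with
  | fTrue | fFalse | fRel _ _ | fEq _ _ => True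
  | fNot psi => free_for s psi
  | fAnd psi1 psi2 | fOr psi1 psi2 => free_for s psi1 /\ free_for s psi2
  | fAll i psi | fEx i psi =>
      (forall j, free_vars psi j -> j <> i -> s j <> i) /\
      free_for (update s i i) psi
  | fBigAnd f | fBigOr f => forall k, free_for s (f k)
  end.

Definition immediate_subformulas (L : language) (phi : formula L) :
    set (formula L) :=
  match phi with
  | fTrue | fFalse | fRel _ _ | fEq _ _ => set0
  | fNot psi | fAll _ psi | fEx _ psi => [set psi]
  | fAnd psi1 psi2 | fOr psi1 psi2 => [set psi1; psi2]
  | fBigAnd f | fBigOr f => range f
  end.

Record fragment (L : language) (F : set (formula L)) : Prop := Fragment {
  fragment_wf : F `<=` @well_formed L;
  fragment_true : F fTrue;
  fragment_false : F fFalse;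
  fragment_rel : forall (R : rsym L) (t : (arity R).-tuple nat), F (fRel R t);
  fragment_eq : forall i j, F (fEq i j);
  fragment_sub : forall phi, F phi -> immediate_subformulas phi `<=` F;
  fragment_not : forall phi, F phi -> F (fNot phi);
  fragment_and : forall phi psi, F phi -> F psi -> F (fAnd phi psi);
  fragment_or : forall phi psi, F phi -> F psi -> F (fOr phi psi);
  fragment_all : forall i phi, F phi -> F (fAll i phi);
  fragment_ex : forall i phi, F phi -> F (fEx i phi);
  fragment_subst : forall s phi, F phi -> free_for s phi -> F (subst s phi)
}.

Definition Str (L : language) : Type := structure L nat.

Section StrTopology.
Variable L : language.

HB.instance Definition _ := gen_eqMixin (Str L).
HB.instance Definition _ := gen_choiceMixin (Str L).
HB.instance Definition _ := isPointed.Build (Str L) (fun _ _ => False).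

Definition Str_subbase : set (set (Str L)) :=
  [set U | exists (R : rsym L) (a : (arity R).-tuple nat),
    U = [set M : Str L | M R a] \/ U = [set M : Str L | ~ M R a]].

HB.instance Definition _ :=
  @isSubBaseTopological.Build (Str L) (set (Str L)) Str_subbase id.

HB.instance Definition _ :=
  @isMeasurable.Build (sigma_display (@open (Str L))) (Str L)
    <<s @open (Str L) >> (@sigma_algebra0 _ setT _)
    (@sigma_algebraC (Str L) _) (@sigma_algebra_bigcup _ setT _).

End StrTopology.

Notation Sym_nat := ({splitbij [set: nat] >-> [set: nat]}).

Definition logic_action (L : language) (s : Sym_nat) (M : Str L) : Str L :=
  fun R a => M R (map_tuple s^-1 a).

Definition orbit_of (L : language) (M : Str L) : set (Str L) :=
  [set logic_action s M | s in [set: Sym_nat]].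

Local Open Scope ereal_scope.

Definition invariant (L : language) (R : realType)
    (mu : probability (Str L) R) : Prop :=
  forall (s : Sym_nat) (X : set (Str L)), measurable X ->
    mu (logic_action s @` X) = mu X.

Definition ergodic (L : language) (R : realType)
    (mu : probability (Str L) R) : Prop :=
  forall X : set (Str L), measurable X ->
    (forall s : Sym_nat, mu (X `+` (logic_action s @` X)) = 0) ->
    mu X = 0 \/ mu X = 1.

Definition ergodic_structure (L : language) (R : realType)
    (mu : probability (Str L) R) : Prop :=
  invariant mu /\ ergodic mu.

Definition properly_ergodic (L : language) (R : realType)
    (mu : probability (Str L) R) : Prop :=
  ergodic_structure mu /\ forall M : Str L, mu (orbit_of M) = 0.

Definition theory (L : language) (R : realType) (F : set (formula L))
    (mu : probability (Str L) R) : set (formula L) :=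
  [set phi | [/\ F phi, sentence phi & mu [set M : Str L | models M phi] = 1]].

(* [mu (phi(x))] is computed at the tuple [(0, ..., n-1)]; for invariant [mu]
   any tuple of distinct elements gives the same value. *)
Definition mu_formula (L : language) (R : realType)
    (mu : probability (Str L) R) (n : nat) (x : n.-tuple nat)
    (phi : formula L) : \bar R :=
  mu [set M : Str L | sat_at M x (iota_tuple n 0) phi].

Definition mu_type (L : language) (R : realType)
    (mu : probability (Str L) R) (n : nat) (x : n.-tuple nat)
    (p : set (formula L)) : \bar R :=
  mu [set M : Str L | forall phi, p phi -> sat_at M x (iota_tuple n 0) phi].

Definition type_of (L : language) (F : set (formula L)) (T : pointedType)
    (M : structure L T) (n : nat) (x : n.-tuple nat) (a : n.-tuple T) :
    set (formula L) :=
  [set psi | [/\ F psi, free_vars psi `<=` [set` x] & sat_at M x a psi]].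

Definition is_type (L : language) (F : set (formula L)) (n : nat)
    (x : n.-tuple nat) (p : set (formula L)) : Prop :=
  exists (T : pointedType) (M : structure L T) (a : n.-tuple T),
    p = type_of F M x a.

Definition realizes (L : language) (F : set (formula L)) (T : pointedType)
    (M : structure L T) (n : nat) (x : n.-tuple nat) (p : set (formula L))
    (a : n.-tuple T) : Prop :=
  p = type_of F M x a.

Definition root (L : language) (F : set (formula L)) (T : pointedType)
    (M : structure L T) (n : nat) (x : n.-tuple nat) (p : set (formula L))
    (c : T) : Prop :=
  forall b : n.-tuple T, realizes F M x p b -> c \in b.

Definition distinct_formula (L : language) (x : seq nat) : formula L :=
  foldr (@fAnd L) fTrue
    [seq fNot (fEq ij.1 ij.2) | ij <- [seq (i, j) | i <- x, j <- x]
                              & ij.1 != ij.2].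

Definition chi_distinct (L : language) (x : seq nat) (chi : formula L) :
    formula L :=
  foldr (@fAll L) (fImp chi (distinct_formula L x)) x.

Definition chi_rooted (L : language) (F : set (formula L)) (T : pointedType)
    (M : structure L T) (n : nat) (x : n.-tuple nat) (chi : formula L) : Prop :=
  forall p : set (formula L), is_type F x p -> p chi ->
    (exists a : n.-tuple T, realizes F M x p a) ->
    exists c : T, root F M x p c.

Definition chi_rooted_models (L : language) (F Th : set (formula L)) (n : nat)
    (x : n.-tuple nat) (chi : formula L) : set (Str L) :=
  [set M : Str L | (forall phi, Th phi -> models M phi) /\
                   chi_rooted F M x chi].

(* Main.v *)
Require Import Defs.
From mathcomp Require Import all_boot all_order all_algebra finmap.
From mathcomp Require Import all_classical all_reals all_analysis.
From mathcomp Require Import measurable_realfun.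
From mathcomp Require Import ring lra zify.

(** Write X_a for the F-type of a tuple a in the random structure M.  Two
    facts about the family of all the X_a, each true almost surely, give
    rootedness by a counting argument.

    Disjointness.  If a and b are disjoint, then X_a = X_b with chi in X_a has
    probability 0 ([disjoint_same_type_null]).  Ergodicity makes types of
    disjoint tuples independent: for a set B of types let U_i be the event
    that the i-th block of n consecutive numbers has its type in B.  The
    empirical frequencies of the U_i along the first N blocks form a Cauchy
    sequence in L2, because distinct U_i are pairwise equally correlated, and
    moving the blocks by a permutation of the numbers changes the average by
    O(1/N) in squared L2 norm, because a moved block meets at most n of the
    original ones ([avg_diff_sq]).  Along N = 8 ^ k these estimates are
    summable, so the frequencies converge almost surely to a limit that is
    almost surely invariant, and ergodicity decides whether this limit is at
    most P(U_0).  Integrating the limit over the whole space and over U_0 then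
    gives P(U_0 and U_1) <= P(U_0)^2 ([pair_le_sq], [disjoint_le_sq]).  Now
    cut the types containing chi into the finitely many cells given by the
    first k formulas of F: X_a = X_b forces a and b into the same cell, so the
    probability is at most the sum of the squares of the measures of the
    cells.  As no single type has positive measure, the cells of measure at
    least epsilon have total measure tending to 0 with k ([heavy_cvg0]), and
    the sum of squares tends to 0.

    Recurrence.  If X_a = X_b, then for every K there is b' with X_b' = X_a
    whose entries below K all lie in both a and b ([recurrence_null]).  Indeed
    enlarge K beyond all entries of a and b, and let b_i be b with the entries
    outside a shifted by iK.  A permutation exchanges b and b_i and fixes a and
    the other b_j, so the event that, among b_0, ..., b_N, only b_i has the
    type of a has the same probability for every i <= N.  These N + 1 events
    are disjoint, so that probability is at most 1/(N + 1).

    Counting ([common_entry]).  Let p contain chi and be realized in M.  Among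
    the pairs of realizations of p choose (a, b) with the fewest common
    entries; by disjointness there is at least one.  If some realization e
    missed one of them, recurrence would give a realization b', sharing with e
    only entries common to a and b, hence strictly fewer.  So every common
    entry of a and b is a root of p. *)

Set Implicit Arguments.
Unset Strict Implicit.
Unset Printing Implicit Defensive.
Import Order.TTheory GRing.Theory Num.Theory.
Import numFieldNormedType.Exports.

Local Open Scope classical_set_scope.
Local Open Scope ring_scope.

(** * Empirical frequencies of equally correlated events *)

Lemma cvg_geometric_steps (R : realType) (u : nat -> R) k0 :
  (forall k, (k0 <= k)%N -> `|u k - u k.+1| < 2^-1 ^+ k) -> cvgn u.
Proof.
move=> hu; pose v k := u (k + k0)%N.
suff /cvg_ex[l vl] : cvgn v.
  by apply/cvg_ex; exists l; rewrite -(cvg_shiftn k0).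
have -> : v = (fun k => v 0%N + series (telescope v) k).
  by apply/funext => k; rewrite -eq_sum_telescope.
apply: is_cvgD; first exact: is_cvg_cst.
apply: normed_cvg; apply: (@series_le_cvg _ _ (geometric 1 2^-1)).
- by move=> k /=.
- by move=> k; rewrite /geometric/= mul1r exprn_ge0.
- move=> k; rewrite /geometric/= mul1r /telescope/= distrC /v addSn.
  apply: (le_trans (ltW (hu _ _))); first by rewrite leq_addl.
  by apply: ler_wiXn2l; rewrite ?leq_addr// invf_le1// ler1n.
- by apply: is_cvg_geometric_series; rewrite ger0_norm ?invr_ge0// invf_lt1 ?ltr1n.
Qed.

Definition avg (R : realType) (T : Type) (U : nat -> set T) (N : nat) (t : T) : R :=
  N%:R^-1 * \sum_(i < N) \1_(U i) t.

(** The growth 8 ^ k beats the factor 4 ^ k lost in bounding the probability of a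
    deviation of size 2 ^- k, so that deviations along this subsequence are
    summable.  An upper limit is defined and measurable everywhere, while the
    limit itself exists only almost surely. *)
Definition freq (R : realType) (T : Type) (U : nat -> set T) (t : T) : R :=
  fine (limn_esup (fun k => (avg R U (8 ^ k) t)%:E)).

Section Averages.
Context {d : measure_display} {T : measurableType d} {R : realType}
  (P : probability T R).
Implicit Types U V : nat -> set T.

Lemma fine_prob_le1 X : measurable X -> fine (P X) <= 1.
Proof. by move=> mX; rewrite -lee_fin fineK ?fin_num_measure// probability_le1. Qed.

Lemma measurable_sublevel (f : T -> R) (r : R) :
  measurable_fun setT f -> measurable [set t | f t <= r].
Proof.
move=> mf; rewrite -[X in measurable X]setTI (_ : [set t | _] = f @^-1` `]-oo, r]).
  exact: mf.
by apply/seteqP; split=> t /=; rewrite in_itv.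
Qed.

Lemma measurable_norm_superlevel (f : T -> R) (r : R) :
  measurable_fun setT f -> measurable [set t | r <= `|f t|].
Proof.
move=> mf; rewrite -[X in measurable X]setTI
  (_ : [set t | _] = (fun t => `|f t|) @^-1` `[r, +oo[).
  by apply: (measurableT_comp _ mf).
by apply/seteqP; split=> t /=; rewrite in_itv/= andbT.
Qed.

Lemma avg_ge0 U N t : 0 <= avg R U N t.
Proof. by rewrite mulr_ge0 ?invr_ge0 ?ler0n// sumr_ge0. Qed.

Lemma avg_le1 U N t : avg R U N t <= 1.
Proof.
case: N => [|N]; first by rewrite /avg big_ord0 mulr0.
rewrite /avg ler_pdivrMl ?ltr0n// mulr1.
rewrite (@le_trans _ _ (\sum_(i < N.+1) 1))//; last by rewrite sumr_const card_ord.
by apply: ler_sum => i _; rewrite indicE; case: (_ \in _); rewrite ?ler01.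
Qed.

Lemma measurable_avg U N : (forall i, measurable (U i)) ->
  measurable_fun setT (avg R U N).
Proof.
move=> mU; apply: measurable_funM => //; apply: measurable_sum => i.
exact: measurable_indic.
Qed.

Lemma bounded_integrable (f : T -> R) (K : R) : measurable_fun setT f ->
  (forall t, `|f t| <= K) -> P.-integrable setT (EFin \o f).
Proof.
move=> mf fK; apply: measurable_bounded_integrable => //.
  exact: (le_lt_trans (probability_le1 P measurableT) (ltry _)).
by exists K; split; [exact: num_real|move=> M KM t _ /=; rewrite (le_trans (fK t))// ltW].
Qed.

Lemma Rintegral_sum_nat (f : nat -> T -> R) N :
  (forall i, P.-integrable setT (EFin \o f i)) ->
  \int[P]_t (\sum_(i < N) f i t) = \sum_(i < N) \int[P]_t f i t.
Proof.
move=> fi; elim: N => [|N IH].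
  rewrite big_ord0 (@eq_Rintegral _ _ _ _ _ (cst 0)); last first.
    by move=> t _; rewrite big_ord0.
  by rewrite Rintegral_cst// mul0r.
under eq_Rintegral do rewrite big_ord_recr.
rewrite RintegralD//=; first by rewrite IH big_ord_recr.
rewrite (_ : _ \o _ = fun t => (\sum_(i < N) (f i t)%:E)%E); last first.
  by apply/funext => t /=; rewrite sumEFin.
by apply: integrable_sum => // i _; exact: fi.
Qed.

Lemma integral_avgM U V N N' : (forall i, measurable (U i)) ->
  (forall i, measurable (V i)) ->
  \int[P]_t (avg R U N t * avg R V N' t) =
  N%:R^-1 * N'%:R^-1 *
    \sum_(i < N) \sum_(j < N') fine (P (U i `&` V j)).
Proof.
move=> mU mV.
have mUV i j : measurable (U i `&` V j) by exact: measurableI.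
have ii i j : P.-integrable setT (EFin \o (\1_(U i `&` V j) : T -> R)).
  exact: integrable_indic.
have is_ i : P.-integrable setT
    (EFin \o (fun t => \sum_(j < N') \1_(U i `&` V j) t)).
  apply: (@bounded_integrable _ N'%:R).
    by apply: measurable_sum => j; exact: measurable_indic.
  move=> t; rewrite ger0_norm ?sumr_ge0//.
  rewrite (@le_trans _ _ (\sum_(i < N') 1))//; last by rewrite sumr_const card_ord.
  by apply: ler_sum => j _; rewrite indicE; case: (_ \in _); rewrite ?ler01.
under eq_Rintegral.
  move=> t _.
  rewrite (_ : _ * _ = (N%:R^-1 * N'%:R^-1) *
     (\sum_(i < N) \sum_(j < N') \1_(U i `&` V j) t)); last first.
    rewrite /avg mulrACA; congr (_ * _); rewrite mulr_suml; apply: eq_bigr => i _.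
    by rewrite mulr_sumr; apply: eq_bigr => j _; rewrite indicI.
  over.
rewrite RintegralZl//; last first.
  rewrite (_ : _ \o _ = fun t => (\sum_(i < N)
      (\sum_(j < N') \1_(U i `&` V j) t)%:E)%E); last first.
    by apply/funext => t /=; rewrite sumEFin.
  by apply: integrable_sum => // i _; exact: is_.
congr (_ * _).
rewrite (@Rintegral_sum_nat (fun i t => \sum_(j < N') \1_(U i `&` V j) t))//.
apply: eq_bigr => i _.
rewrite (@Rintegral_sum_nat (fun j t => \1_(U i `&` V j) t))//.
by apply: eq_bigr => j _; rewrite /Rintegral integral_indic// setIT.
Qed.

Lemma chebyshev_sq (f : T -> R) (K e : R) : 0 < e -> measurable_fun setT f ->
  (forall t, `|f t| <= K) ->
  fine (P [set t | e <= `|f t|]) <= e ^- 2 * \int[P]_t (f t ^+ 2).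
Proof.
move=> e0 mf fK.
have mA := measurable_norm_superlevel e mf.
have mf2 : measurable_fun setT (fun t => f t ^+ 2) by exact: measurable_funX.
rewrite ler_pdivlMl ?exprn_gt0//.
have -> : e ^+ 2 * fine (P [set t | e <= `|f t|]) =
    \int[P]_t (e ^+ 2 * \1_[set t | e <= `|f t|] t).
  rewrite RintegralZl//; last exact: integrable_indic.
  by rewrite /Rintegral integral_indic// setIT.
apply: le_Rintegral => //.
- apply: (@bounded_integrable _ (e ^+ 2)).
    by apply: measurable_funM => //; exact: measurable_indic.
  move=> t; rewrite indicE; case: (_ \in _); rewrite ?mulr1 ?mulr0 ?normr0 ?sqr_ge0//.
  by rewrite ger0_norm ?sqr_ge0.
- apply: (@bounded_integrable _ (K ^+ 2)) => // t.
  by rewrite normrX lerXn2r ?nnegrE// (le_trans _ (fK t)).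
- move=> t _; rewrite indicE; have [|] := boolP (t \in _); last by rewrite mulr0 sqr_ge0.
  rewrite inE /= mulr1 => et; rewrite -[f t ^+ 2]real_normK ?num_real//.
  by rewrite lerXn2r ?nnegrE// ltW.
Qed.

Lemma sum_eqb_le1 (i N : nat) : (\sum_(j < N) (i == j) <= 1)%N.
Proof.
case: (ltnP i N) => iN.
  rewrite (bigD1 (Ordinal iN))//= eqxx big1 ?addn0// => j.
  by rewrite -val_eqE/= eq_sym => /negbTE ->.
rewrite big1// => j _; case: eqP => // ij.
by move: (ltn_ord j); rewrite -ij ltnNge iN.
Qed.

(** The N diagonal terms contribute O(1/N) to a mean over N ^ 2 pairs; likewise,
    in the next lemma, the at most n exceptional terms of each row. *)
Lemma mean_pairs_le (a : nat -> nat -> R) (c : R) N :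
  (forall i j, a i j <= c + (i == j)%:R) -> (0 < N)%N ->
  N%:R^-1 * N%:R^-1 * (\sum_(i < N) \sum_(j < N) a i j) <= c + N%:R^-1.
Proof.
move=> ac N0; have N0' : 0 < N%:R :> R by rewrite ltr0n.
rewrite -mulrA ler_pdivrMl// ler_pdivrMl//.
apply: (@le_trans _ _ (\sum_(i < N) (N%:R * c + 1))); last first.
  rewrite sumr_const card_ord -mulr_natl; rewrite le_eqVlt; apply/orP; left.
  by apply/eqP; field; rewrite pnatr_eq0 -lt0n.
apply: ler_sum => i _.
apply: (@le_trans _ _ (\sum_(j < N) (c + (i == j :> nat)%:R))).
  by apply: ler_sum => j _; exact: ac.
rewrite big_split/= sumr_const card_ord mulr_natl lerD2l -natr_sum.
by rewrite (ler_nat _ _ 1) sum_eqb_le1.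
Qed.

Lemma mean_pairs_ge (a : nat -> nat -> R) (bad : nat -> nat -> bool) (c : R)
    n N N' :
  (forall i j, c <= a i j + (bad i j)%:R) ->
  (forall i, \sum_(j < N') bad i j <= n)%N -> (0 < N)%N -> (0 < N')%N ->
  c <= N%:R^-1 * N'%:R^-1 * (\sum_(i < N) \sum_(j < N') a i j) + n%:R / N'%:R.
Proof.
move=> ac badn N0 N'0.
have N0' : 0 < N%:R :> R by rewrite ltr0n.
have N'0' : 0 < N'%:R :> R by rewrite ltr0n.
have : \sum_(i < N) (N'%:R * c - n%:R) <= \sum_(i < N) \sum_(j < N') a i j.
  apply: ler_sum => i _; rewrite lerBlDr.
  apply: (@le_trans _ _ (\sum_(j < N') (a i j + (bad i j)%:R))).
    rewrite mulr_natl -[X in c *+ X]card_ord -sumr_const.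
    by apply: ler_sum => j _; exact: ac.
  by rewrite big_split/= lerD2l -natr_sum ler_nat.
rewrite sumr_const card_ord -[leLHS]mulr_natl => h.
rewrite -lerBlDr -mulrA ler_pdivlMl// ler_pdivlMl//.
apply: le_trans h; rewrite le_eqVlt; apply/orP; left.
by apply/eqP; field; rewrite pnatr_eq0 -lt0n.
Qed.

(** Expanding the square, each of the three double means is c up to the
    exceptional pairs, so that the main terms c - 2c + c cancel. *)
Lemma avg_diff_sq U V (bad : nat -> nat -> bool) (c : R) n N N' :
  (forall i, measurable (U i)) -> (forall i, measurable (V i)) ->
  (forall i j, fine (P (U i `&` U j)) <= c + (i == j)%:R) ->
  (forall i j, fine (P (V i `&` V j)) <= c + (i == j)%:R) ->
  (forall i j, c <= fine (P (U i `&` V j)) + (bad i j)%:R) ->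
  (forall i M, \sum_(j < M) bad i j <= n)%N -> (0 < N)%N -> (N <= N')%N ->
  \int[P]_t ((avg R U N t - avg R V N' t) ^+ 2) <= (n.+1.*2)%:R / N%:R.
Proof.
move=> mU mV hU hV hUV hbad N0 NN'.
have N'0 : (0 < N')%N by exact: leq_trans NN'.
have mM (A B : nat -> set T) M M' :
    (forall i, measurable (A i)) -> (forall i, measurable (B i)) ->
    P.-integrable setT (EFin \o (fun t => avg R A M t * avg R B M' t)).
  move=> mX mY; apply: (@bounded_integrable _ 1).
    by apply: measurable_funM; exact: measurable_avg.
  move=> t; rewrite normrM !ger0_norm ?avg_ge0//.
  by rewrite mulr_ile1 ?avg_ge0 ?avg_le1.
have mMZ (A B : nat -> set T) M M' :
    (forall i, measurable (A i)) -> (forall i, measurable (B i)) ->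
    P.-integrable setT (EFin \o (fun t => 2 * (avg R A M t * avg R B M' t))).
  by move=> mX mY; exact: (integrableZl _ _ (mM _ _ M M' mX mY)).
have -> : \int[P]_t ((avg R U N t - avg R V N' t) ^+ 2) =
  \int[P]_t (avg R U N t * avg R U N t) + \int[P]_t (avg R V N' t * avg R V N' t)
  - 2 * \int[P]_t (avg R U N t * avg R V N' t).
  rewrite -RintegralZl//; last exact: mM.
  rewrite -RintegralD//; [|exact: mM..].
  rewrite -RintegralB//; [| |exact: mMZ]; last first.
    exact: (integrableD measurableT (mM _ _ _ _ mU mU) (mM _ _ _ _ mV mV)).
  by apply: eq_Rintegral => t _; ring.
rewrite !integral_avgM//.
have h1 := mean_pairs_le hU N0.
have h2 := mean_pairs_le hV N'0.
have h3 := mean_pairs_ge hUV (hbad^~ N') N0 N'0.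
have N0' : 0 < N%:R :> R by rewrite ltr0n.
have h4 : N'%:R^-1 <= N%:R^-1 :> R by rewrite lef_pV2 ?posrE ?ltr0n// ler_nat.
have h5 : n%:R / N'%:R <= n%:R / N%:R :> R by rewrite ler_wpM2l.
have -> : n.+1.*2%:R / N%:R = 2 * (n%:R / N%:R) + 2 * N%:R^-1 :> R.
  by rewrite -muln2 natrM -natr1; ring.
move: h1 h2 h3 h4 h5; set A := _ * _ * _; set B := _ * _ * _; set C := _ * _ * _.
by lra.
Qed.

(** Borel-Cantelli applied to the preceding variance bound. *)
Lemma ae_avg_diff_small U V (bad : nat -> nat -> bool) (c : R) n (s : nat -> nat) :
  (forall i, measurable (U i)) -> (forall i, measurable (V i)) ->
  (forall i j, i != j -> fine (P (U i `&` U j)) = c) ->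
  (forall i j, i != j -> fine (P (V i `&` V j)) = c) ->
  (forall i j, ~~ bad i j -> fine (P (U i `&` V j)) = c) ->
  (forall i M, \sum_(j < M) bad i j <= n)%N -> (forall k, 8 ^ k <= s k)%N ->
  {ae P, forall t, exists k0, forall k, (k0 <= k)%N ->
    `|avg R U (8 ^ k) t - avg R V (s k) t| < 2^-1 ^+ k}.
Proof.
move=> mU mV cU cV cUV hbad hs.
have c01 : 0 <= c <= 1.
  rewrite -(cU 0%N 1%N)// fine_ge0//= fine_prob_le1//; exact: measurableI.
have up (W : nat -> set T) : (forall i, measurable (W i)) ->
    (forall i j, i != j -> fine (P (W i `&` W j)) = c) ->
    forall i j, fine (P (W i `&` W j)) <= c + (i == j)%:R.
  move=> mW hW i j; case: eqP => [_|/eqP/hW ->]; last by rewrite addr0.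
  rewrite (le_trans (fine_prob_le1 _))//; first exact: measurableI.
  by rewrite lerDr; case/andP: c01.
have hU := up _ mU cU; have hV := up _ mV cV.
have hUV i j : c <= fine (P (U i `&` V j)) + (bad i j)%:R.
  case: (boolP (bad i j)) => [_|/cUV ->]; last by rewrite addr0.
  by rewrite ler_wpDl ?fine_ge0//; case/andP: c01.
pose f k t := avg R U (8 ^ k) t - avg R V (s k) t.
have mf k : measurable_fun setT (f k).
  by apply: measurable_funB; exact: measurable_avg.
pose E k := [set t | 2^-1 ^+ k <= `|f k t|].
have mE k : measurable (E k) by exact: measurable_norm_superlevel.
have PE k : (P (E k) <= (geometric n.+1.*2%:R 2^-1 k)%:E)%E.
  rewrite -[leLHS]fineK ?fin_num_measure// lee_fin.
  apply: (@le_trans _ _ ((2^-1 ^+ k) ^- 2 * \int[P]_t (f k t ^+ 2))).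
    apply: (@chebyshev_sq _ 2) => //.
    move=> t; rewrite (le_trans (ler_normB _ _))//.
    rewrite !ger0_norm ?avg_ge0//.
    by have := avg_le1 U (8 ^ k) t; have := avg_le1 V (s k) t; lra.
  rewrite ler_pdivrMl ?exprn_gt0//.
  apply: (le_trans (avg_diff_sq mU mV hU hV hUV hbad _ (hs k))).
    by rewrite expn_gt0.
  rewrite /geometric/= le_eqVlt; apply/orP; left; apply/eqP.
  have -> : (8 ^ k)%:R^-1 = (2^-1 ^+ k) ^+ 3 :> R.
    rewrite natrX -exprVn -exprM mulnC exprM; congr (_ ^+ _).
    by rewrite exprVn -natrX.
  by ring.
have LS : P (lim_sup_set E) = 0%E.
  apply: lim_sup_set_cvg0 => //.
  apply: (@le_lt_trans _ _ (\sum_(k <oo) (geometric n.+1.*2%:R 2^-1 k)%:E)%E).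
    by apply: lee_nneseries => k _ //; exact: PE.
  have cg := @cvg_geometric_series R n.+1.*2%:R 2^-1.
  rewrite [X in (X < _)%E](_ : _ = (n.+1.*2%:R * (1 - 2^-1)^-1)%:E) ?ltry//.
  apply/cvg_lim => //.
  have : EFin (series (geometric n.+1.*2%:R (2^-1 : R)) k) @[k --> \oo] -->
      (n.+1.*2%:R * (1 - 2^-1)^-1 : R)%:E.
    apply: cvg_EFin; first exact: nearW.
    by apply: cg; rewrite ger0_norm ?invr_ge0// invf_lt1 ?ltr1n.
  apply: cvg_trans; apply: near_eq_cvg; apply: nearW => k.
  by rewrite /series/= sumEFin.
exists (lim_sup_set E); split => //.
  apply: bigcap_measurable => // k _.
  by apply: bigcup_measurable => j _; exact: mE.
move=> t /= /forallNP h k _.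
have [j] : exists j, ~ ((k <= j)%N -> `|f j t| < 2^-1 ^+ j).
  by apply/existsNP; apply: h.
by move/not_implyP => [kj /negP]; rewrite -leNgt => Ej; exists j.
Qed.

Lemma ae_avg_cvg U (c : R) : (forall i, measurable (U i)) ->
  (forall i j, i != j -> fine (P (U i `&` U j)) = c) ->
  {ae P, forall t, avg R U (8 ^ k) t @[k --> \oo] --> freq R U t}.
Proof.
move=> mU cU.
have := @ae_avg_diff_small U U eq_op c 1 (fun k => 8 ^ k.+1)%N mU mU cU cU cU.
move=> /(_ sum_eqb_le1 (fun k => @leq_pexp2l 8 _ _ isT (leqnSn k))).
apply: filterS => t [k0 /cvg_geometric_steps cu].
suff -> : freq R U t = limn (fun k => avg R U (8 ^ k) t) by [].
rewrite /freq is_cvg_limn_esupE.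
  by rewrite EFin_lim.
apply/cvg_ex; exists (limn (fun k => avg R U (8 ^ k) t))%:E.
by apply: cvg_EFin => //; exact: nearW.
Qed.

Lemma freq_itv01 U t : 0 <= freq R U t <= 1.
Proof.
rewrite /freq; set u := (X in limn_esup X).
have u0 k : (0 <= u k)%E by rewrite /u/= lee_fin avg_ge0.
have u1 k : (u k <= 1)%E by rewrite /u/= lee_fin avg_le1.
have : (0 <= limn_esup u <= 1)%E.
  rewrite limn_esup_lim; apply/andP; split.
    apply: lime_ge; first exact: is_cvg_esups.
    by apply: nearW => k; apply: (le_trans (u0 k)); apply: ereal_sup_ubound; exists k => /=.
  apply: lime_le; first exact: is_cvg_esups.
  by apply: nearW => k; apply: ge_ereal_sup => _ [j _ <-].
case: (limn_esup u) => [r||] /=; first by rewrite !lee_fin.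
  by rewrite lexx ler01.
by rewrite lexx ler01.
Qed.

Lemma measurable_freq U : (forall i, measurable (U i)) ->
  measurable_fun setT (freq R U).
Proof.
move=> mU; apply: measurableT_comp => //.
apply: measurable_fun_limn_esup => k.
by apply/measurable_EFinP; exact: measurable_avg.
Qed.

Lemma integral_freq U (c : R) (D : set T) : (forall i, measurable (U i)) ->
  (forall i j, i != j -> fine (P (U i `&` U j)) = c) -> measurable D ->
  (\int[P]_(t in D) (avg R U (8 ^ k) t)%:E)%E @[k --> \oo] -->
    (\int[P]_(t in D) (freq R U t)%:E)%E.
Proof.
move=> mU hU mD.
have [//|//||//||_ _ //] := @dominated_convergence _ _ _ P D mD
  (fun k t => (avg R U (8 ^ k) t)%:E) (fun t => (freq R U t)%:E) (cst 1%E).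
- move=> k; apply/measurable_EFinP; apply: (measurable_funS measurableT) => //.
  exact: measurable_avg.
- apply/measurable_EFinP; apply: (measurable_funS measurableT) => //.
  exact: measurable_freq.
- apply: filterS (ae_avg_cvg mU hU) => t h _.
  by apply: cvg_EFin => //; exact: nearW.
- exact: finite_measure_integrable_cst.
- apply: aeW => t k _; rewrite lee_fin ger0_norm ?avg_ge0 ?avg_le1//.
Qed.

(** Only the term i = 0 can differ from c, and its weight 8 ^- k vanishes. *)
Lemma limit_mean_inter U (c : R) (D : set T) : (forall i, measurable (U i)) ->
  measurable D -> (forall i, (0 < i)%N -> fine (P (D `&` U i)) = c) ->
  (\int[P]_(t in D) (avg R U (8 ^ k) t)%:E)%E @[k --> \oo] --> c%:E.
Proof.
move=> mU mD hU.
have hsum N : (\int[P]_(t in D) (avg R U N t)%:E =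
    (N%:R^-1 * \sum_(i < N) fine (P (D `&` U i)))%:E)%E.
  rewrite (_ : (fun t => (avg R U N t)%:E) =
      fun t => ((N%:R^-1)%:E * \sum_(i < N) (\1_(U i) t)%:E)%E); last first.
    by apply/funext => t; rewrite sumEFin -EFinM.
  have ii i : P.-integrable D (EFin \o (\1_(U i) : T -> R)).
    by apply: (integrableS measurableT) => //; exact: integrable_indic.
  rewrite integralZl//; last by apply: integrable_sum => // i _; exact: ii.
  rewrite integral_sum//; last by move=> i; exact: ii.
  rewrite EFinM -sumEFin; congr (_ * _)%E; apply: eq_bigr => i _.
  rewrite integral_indic// setIC fineK// fin_num_measure//; exact: measurableI.
pose e := fine (P (D `&` U 0%N)) - c.
have hE k : c + geometric e 8^-1 k =
    (8 ^ k)%:R^-1 * \sum_(i < 8 ^ k) fine (P (D `&` U i)).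
  apply/esym; rewrite /geometric/=.
  have k0 : (0 < 8 ^ k)%N by rewrite expn_gt0.
  rewrite -(prednK k0) big_ord_recl/= (eq_bigr (fun=> c)); last first.
    by move=> i _; rewrite hU.
  rewrite sumr_const card_ord exprVn -natrX -[in RHS](prednK k0) -[c *+ _]mulr_natl.
  rewrite /e; field; by rewrite addrC natr1 pnatr_eq0.
suff h : (fun k => c + geometric e 8^-1 k) k @[k --> \oo] --> c.
  under eq_cvg do rewrite hsum.
  apply: cvg_EFin; first exact: nearW.
  by apply: cvg_trans h; apply: near_eq_cvg; apply: nearW => k; exact: hE.
rewrite -[X in _ --> X]addr0; apply: cvgD; first exact: cvg_cst.
by apply: cvg_geometric; rewrite ger0_norm ?invr_ge0// invf_lt1 ?ltr1n.
Qed.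

(** The limit frequency has integral q over the whole space and c over U 0.
    If it were almost surely greater than q, its integral would exceed q; so
    the zero-one hypothesis makes it almost surely at most q, and its integral
    over U 0 is at most q * P (U 0). *)
Lemma pair_le_sq U (q c : R) : (forall i, measurable (U i)) ->
  (forall i, P (U i) = q%:E) ->
  (forall i j, i != j -> fine (P (U i `&` U j)) = c) ->
  P [set t | freq R U t <= q] = 0%E \/ P [set t | freq R U t <= q] = 1%E ->
  c <= q * q.
Proof.
move=> mU qU cU.
have mf := measurable_freq mU.
have mG := measurable_sublevel q mf.
have hu (l l' : \bar R) (f : nat -> \bar R) :
    f k @[k --> \oo] --> l -> f k @[k --> \oo] --> l' -> l = l'.
  by move=> fl fl'; rewrite -(cvg_lim _ fl)// -(cvg_lim _ fl').
have intT : (\int[P]_t (freq R U t)%:E = q%:E)%E.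
  apply: hu (integral_freq mU cU measurableT) _ => //.
  apply: limit_mean_inter => // i _.
  by rewrite setTI qU.
have intU : (\int[P]_(t in U 0%N) (freq R U t)%:E = c%:E)%E.
  apply: hu (integral_freq mU cU (mU 0%N)) _ => //.
  by apply: limit_mean_inter => // i i0; rewrite cU// eq_sym -lt0n.
have q0 : 0 <= q by rewrite -lee_fin -(qU 0%N).
case=> G.
- exfalso.
  have hgt : {ae P, forall t, q < freq R U t}.
    exists [set t | freq R U t <= q]; split => // t /=.
    by move/negP; rewrite -leNgt.
  pose f t := (freq R U t - q)%:E.
  have mff : measurable_fun setT f.
    by apply/measurable_EFinP; apply: measurable_funB.
  have : (\int[P]_t `|f t| = 0)%E.
    rewrite (ae_eq_integral f)//; last first.
      apply: filterS hgt => t ht _; rewrite /f/= ger0_norm// subr_ge0 ltW//.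
      by apply: measurableT_comp.
    rewrite /f; under eq_integral do rewrite EFinB.
    rewrite integralB_EFin//; last 2 first.
    - apply: (@bounded_integrable _ 1) => // t.
      by have /andP[? ?] := freq_itv01 U t; rewrite ger0_norm.
    - exact: finite_measure_integrable_cst.
    by rewrite intT integral_cst//= probability_setT mule1 subee.
  move/(ae_eq_integral_abs _ measurableT mff) => h.
  have : {ae P, forall t, False}.
    apply: filterS2 h hgt => t /(_ I) /eqP; rewrite /f/= eqe subr_eq0 => /eqP ->.
    by rewrite ltxx.
  case=> N [mN N0 hN].
  have := probability_setT P; rewrite (_ : setT = N).
    by rewrite N0 => -[] /eqP; rewrite eq_sym oner_eq0.
  by apply/seteqP; split=> // t _; exact: hN.
- have hle : {ae P, forall t, freq R U t <= q}.
    exists (~` [set t | freq R U t <= q]); split => //; first exact: measurableC.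
    by rewrite probability_setC// G subee.
  rewrite -lee_fin -intU EFinM -[X in (_ <= _ * X)%E](qU 0%N) -integral_cst//.
  apply: ae_ge0_le_integral => //.
  + by move=> t _; rewrite lee_fin; have /andP[] := freq_itv01 U t.
  + by apply/measurable_EFinP; apply: (measurable_funS measurableT).
  + by apply: filterS hle => t ht _; rewrite lee_fin.
Qed.

(** Applied below to the events obtained by permuting the universe: the limit
    frequency is almost surely invariant, which brings ergodicity into play. *)
Lemma ae_freq_eq U V (bad : nat -> nat -> bool) (c : R) n :
  (forall i, measurable (U i)) -> (forall i, measurable (V i)) ->
  (forall i j, i != j -> fine (P (U i `&` U j)) = c) ->
  (forall i j, i != j -> fine (P (V i `&` V j)) = c) ->
  (forall i j, ~~ bad i j -> fine (P (U i `&` V j)) = c) ->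
  (forall i M, \sum_(j < M) bad i j <= n)%N ->
  {ae P, forall t, freq R U t = freq R V t}.
Proof.
move=> mU mV hU hV hUV hbad.
have hs := @ae_avg_diff_small U V bad c n (fun k => 8 ^ k)%N mU mV
  hU hV hUV hbad (fun k => leqnn _).
apply: (filterS3 _ _ hs (ae_avg_cvg mU hU) (ae_avg_cvg mV hV)) => t [k0 hk] cu cv.
have d0 : avg R U (8 ^ k) t - avg R V (8 ^ k) t @[k --> \oo] --> (0 : R).
  have g0 : (2^-1 ^+ k : R) @[k --> \oo] --> (0 : R).
    by apply: cvg_expr; rewrite ger0_norm ?invr_ge0// invf_lt1 ?ltr1n.
  apply: norm_cvg0; apply: (@squeeze_cvgr _ _ _ _ (cst 0) (fun k => 2^-1 ^+ k)) => //.
    by exists k0 => // k /= kk; rewrite normr_ge0/= ltW// hk.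
  exact: cvg_cst.
apply/eqP; rewrite -subr_eq0; apply/eqP.
have e1 := cvg_lim (@Rhausdorff R) (cvgB cu cv).
have e2 := cvg_lim (@Rhausdorff R) d0.
by rewrite -e1; exact: e2.
Qed.
End Averages.

Local Close Scope ring_scope.

(** * Permutations of the natural numbers *)

Definition exchange (p q z : nat) := if z == p then q else if z == q then p else z.

Lemma exchangeK p q : involutive (exchange p q).
Proof.
move=> z; rewrite /exchange; case: (eqVneq z p) => [->|zp].
  by rewrite eqxx; case: eqP.
case: (eqVneq z q) => [->|zq]; first by rewrite eqxx.
by rewrite (negbTE zp) (negbTE zq).
Qed.

(** Makes the probability of an equivariant event depend only on the pattern of
    equalities among the entries of the tuples concerned. *)
Lemma bijection_between (s t : seq nat) : uniq s -> uniq t -> size s = size t ->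
  exists f g, [/\ cancel f g, cancel g f & map f s = t].
Proof.
elim: s t => [|x s IH] [|y t]//= => [_ _ _|/andP[xs us] /andP[yt ut] [st]].
  by exists id, id.
have [f [g [fK gK fst]]] := IH _ us ut st.
exists (exchange (f x) y \o f), (g \o exchange (f x) y); split.
- by move=> z /=; rewrite exchangeK.
- by move=> z /=; rewrite gK exchangeK.
- rewrite /= {1}/exchange eqxx map_comp fst; congr cons.
  rewrite -[RHS]map_id; apply/eq_in_map => z zt; rewrite /exchange /=.
  have zy : z != y by apply: contraNneq yt => <-.
  have zfx : z != f x.
    apply: contraNneq xs => zfx; move: zt; rewrite -fst zfx mem_map//.
    exact: can_inj fK.
  by rewrite (negbTE zy) (negbTE zfx).
Qed.

(** * Types of tuples in an ergodic exchangeable random object *)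

(** The random structure enters only through a measure-preserving, ergodic
    action of the permutations of nat on a probability space and, below, an
    enumerated family H of equivariant properties of n-tuples. *)
Section ExchangeableTypes.
Context {d : measure_display} {T : measurableType d} {R : realType}
  (P : probability T R).
Variables (act : (nat -> nat) -> T -> T) (n : nat).
Hypothesis measurable_act : forall f X, measurable X -> measurable (act f @^-1` X).
Hypothesis act_preserving : forall f g, cancel f g -> cancel g f ->
  forall X, measurable X -> P (act f @^-1` X) = P X.
Hypothesis act_ergodic : forall X, measurable X ->
  (forall f g, cancel f g -> cancel g f -> P (X `+` act f @^-1` X) = 0%E) ->
  P X = 0%E \/ P X = 1%E.

Definition equivariant (E : n.-tuple nat -> set T) := forall f g,
  cancel f g -> cancel g f -> forall a, act f @^-1` E a = E (map_tuple f a).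

Lemma equivariant_inter_measure (E E' : n.-tuple nat -> set T) (a b a' b' : n.-tuple nat) :
  (forall a, measurable (E a)) -> (forall a, measurable (E' a)) ->
  equivariant E -> equivariant E' -> uniq (a ++ b) -> uniq (a' ++ b') ->
  P (E a `&` E' b) = P (E a' `&` E' b').
Proof.
move=> mE mE' eE eE' u u'.
have [|f [g [fK gK]]] := bijection_between u u'; first by rewrite !size_cat !size_tuple.
rewrite map_cat => /eqP; rewrite eqseq_cat ?size_map ?size_tuple// => /andP[/eqP fa /eqP fb].
rewrite -(act_preserving fK gK); last exact: measurableI.
rewrite preimage_setI (eE f g)// (eE' f g)//.
by congr (P (E _ `&` E' _)); apply/val_inj.
Qed.

Lemma equivariant_measure (E : n.-tuple nat -> set T) (a a' : n.-tuple nat) :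
  (forall a, measurable (E a)) -> equivariant E -> uniq a -> uniq a' ->
  P (E a) = P (E a').
Proof.
move=> mE eE u u'.
have [|f [g [fK gK fa]]] := bijection_between u u'; first by rewrite !size_tuple.
by rewrite -(act_preserving fK gK)// (eE f g)//; congr (P (E _)); apply/val_inj.
Qed.

Definition block i : n.-tuple nat := iota_tuple n (i * n).

Lemma block_uniq i : uniq (block i). Proof. exact: iota_uniq. Qed.

Lemma mem_block i j : (j \in block i) -> (j %/ n)%N = i.
Proof.
rewrite mem_iota => /andP[l h].
have n0 : (0 < n)%N by case: (n) l h => //; lia.
by apply/eqP; rewrite eqn_leq leq_divRL// l andbT -ltnS ltn_divLR// mulSn addnC.
Qed.

Lemma block_disjoint i j : i != j -> uniq (block i ++ block j).
Proof.
move=> ij; rewrite cat_uniq !block_uniq andbT/=; apply/hasPn => x xj.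
by apply: contra ij => xi; rewrite -(mem_block xi) -(mem_block xj).
Qed.

(** Whether f maps some entry of block j into block i, where g inverts f. *)
Definition meets (g : nat -> nat) (i j : nat) := has (fun x => (g x %/ n)%N == j) (block i).

Lemma sum_meets g i M : (\sum_(j < M) meets g i j <= n)%N.
Proof.
apply: (@leq_trans (\sum_(j < M) \sum_(x <- block i) ((g x %/ n)%N == j))).
  apply: leq_sum => j _; rewrite /meets.
  elim: (tval _) => [|x s IH]; first by rewrite big_nil.
  by rewrite big_cons /=; case: (_ == _) => //=; rewrite add0n.
rewrite exchange_big/=.
apply: (@leq_trans (\sum_(x <- block i) 1)); last by rewrite sum1_size size_tuple.
by apply: leq_sum => x _; exact: sum_eqb_le1.
Qed.

Lemma freq_act (U : nat -> set T) f t :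
  freq R U (act f t) = freq R (fun i => act f @^-1` U i) t.
Proof. by []. Qed.

(** The empty tuple, for which all blocks coincide, is included: the bound then
    reads P (E a) <= P (E a) ^ 2. *)
Lemma disjoint_le_sq (E : n.-tuple nat -> set T) (a b : n.-tuple nat) :
  (forall a, measurable (E a)) -> equivariant E -> uniq (a ++ b) ->
  (fine (P (E a `&` E b)) <= fine (P (E a)) * fine (P (E a)))%R.
Proof.
move=> mE eE ab.
have ua : uniq a by move: ab; rewrite cat_uniq => /andP[].
pose U i := E (block i).
have mU i : measurable (U i) by exact: mE.
have UP i : P (U i) = (fine (P (E a)))%:E.
  rewrite fineK ?fin_num_measure//.
  exact: (equivariant_measure mE eE (block_uniq i) ua).
have c_disj (a' b' : n.-tuple nat) : uniq (a' ++ b') ->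
    fine (P (E a' `&` E b')) = fine (P (E a `&` E b)).
  by move=> u; congr fine; exact: equivariant_inter_measure.
have UU i j : i != j -> fine (P (U i `&` U j)) = fine (P (E a `&` E b)).
  by move=> ij; apply: c_disj; exact: block_disjoint.
apply: (pair_le_sq mU UP UU).
have mf := measurable_freq (R := R) mU.
apply: act_ergodic => [|f g fK gK]; first exact: measurable_sublevel.
pose V i := act f @^-1` U i.
have mV i : measurable (V i) by exact: measurable_act.
have VE i : V i = E (map_tuple f (block i)) by exact: (eE f g).
have VV i j : i != j -> fine (P (V i `&` V j)) = fine (P (E a `&` E b)).
  move=> ij; rewrite -(UU _ _ ij) /V -preimage_setI (act_preserving fK gK)//.
  exact: measurableI.
have UV i j : ~~ meets g i j -> fine (P (U i `&` V j)) = fine (P (E a `&` E b)).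
  move=> nm; rewrite VE; apply: c_disj; rewrite cat_uniq block_uniq/=.
  rewrite (map_inj_uniq (can_inj fK)) block_uniq andbT.
  apply/hasPn => _ /mapP[y yj ->]; apply: contra nm => fyi.
  by apply/hasP; exists (f y) => //; rewrite fK (mem_block yj).
have [N [mN N0 hN]] := ae_freq_eq mU mV UU VV UV (sum_meets g).
have mG := measurable_sublevel (fine (P (E a))) mf.
apply: (subset_measure0 _ mN _ N0).
  by apply: measurableU; apply: measurableD => //; exact: measurable_act.
move=> t ht; apply: hN => /= e; move: ht; rewrite /preimage/setY/= freq_act -e.
by case=> -[].
Qed.

(** ** Tuples with disjoint entries *)

Variable H : nat -> n.-tuple nat -> set T.
Hypothesis measurable_H : forall k a, measurable (H k a).
Hypothesis equivariant_H : forall k, equivariant (H k).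

Definition same_type (a b : n.-tuple nat) : set T :=
  [set t | forall k, H k a t <-> H k b t].

Lemma measurable_same_type a b : measurable (same_type a b).
Proof.
rewrite (_ : same_type a b =
    \bigcap_k ((H k a `&` H k b) `|` (~` H k a `&` ~` H k b))).
  apply: bigcapT_measurable => k; apply: measurableU; apply: measurableI => //;
  exact: measurableC.
apply/seteqP; split=> t /= h k.
  by move=> _; have [ka|nka] := pselect (H k a t); [left|right]; split => //; [exact/h|move/h].
by have [[]|[]] := h k I.
Qed.

(** The truth values of the first k properties, read as binary digits: numbering
    the cells by integers turns finite partitions into finite sums over
    [code < 2 ^ k]. *)
Fixpoint code k (a : n.-tuple nat) (t : T) : nat :=
  if k is k'.+1 then (`[< H k' a t >] + (code k' a t).*2)%N else 0.

Lemma code_lt k a t : (code k a t < 2 ^ k)%N.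
Proof.
elim: k => //= k IH; rewrite expnS mul2n.
by case: asboolP => _; lia.
Qed.

Lemma codeS_inj k a t t' : code k.+1 a t = code k.+1 a t' ->
  code k a t = code k a t' /\ (H k a t <-> H k a t').
Proof.
move=> /= e; have e1 : `[< H k a t >] = `[< H k a t' >].
  by have := congr1 odd e; rewrite !oddD !odd_double !addbF !oddb.
split; last by split=> h; apply/asboolP; [rewrite -e1|rewrite e1]; exact/asboolP.
by move: e; rewrite e1 => /addnI; exact: double_inj.
Qed.

Lemma eq_code k a b t : same_type a b t -> code k a t = code k b t.
Proof.
move=> h; elim: k => //= k ->; congr (_ + _)%N; congr nat_of_bool.
by apply: asbool_equiv_eq.
Qed.

Lemma measurable_code k a m : measurable [set t | code k a t = m].
Proof.
elim: k m => [|k IH] m /=.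
  have [->|m0] := eqVneq m 0%N.
    by rewrite [X in measurable X](_ : _ = setT)//; apply/seteqP; split.
  rewrite [X in measurable X](_ : _ = set0)//; apply/seteqP; split=> // t /= e.
  by rewrite -e in m0.
rewrite [X in measurable X](_ : _ =
    [set t | code k a t = m./2] `&` (if odd m then H k a else ~` H k a)).
  apply: measurableI; first exact: IH.
  by case: odd => //; exact: measurableC.
apply/seteqP; split=> t /=.
  move=> <-; rewrite oddD odd_double addbF oddb.
  case: asboolP => h; rewrite /= ?add0n ?add1n ?doubleK ?uphalf_double//.
case=> e; case: (boolP (odd m)) => om h; rewrite e -[RHS]odd_double_half.
  by rewrite asboolT// om.
by rewrite asboolF// (negbTE om).
Qed.

Lemma equivariant_code k a f g t : cancel f g -> cancel g f ->
  code k a (act f t) = code k (map_tuple f a) t.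
Proof.
move=> fK gK; elim: k => //= k ->; congr (_ + _)%N; congr nat_of_bool.
apply: asbool_equiv_eq.
by rewrite -(equivariant_H k fK gK).
Qed.

(** The property [H k0] stands for chi. *)
Variable k0 : nat.
Hypothesis nonatomic : forall (a : n.-tuple nat) t, uniq a -> H k0 a t ->
  P [set t' | forall k, H k a t' <-> H k a t] = 0%E.

Definition cell k m a : set T := [set t | code k a t = m] `&` H k0 a.

Lemma measurable_cell k m a : measurable (cell k m a).
Proof. by apply: measurableI => //; exact: measurable_code. Qed.

Lemma equivariant_cell k m : equivariant (cell k m).
Proof.
move=> f g fK gK a; rewrite /cell preimage_setI (equivariant_H k0 fK gK).
by congr (_ `&` _); apply/seteqP; split=> t /=; rewrite (equivariant_code _ _ _ fK gK).
Qed.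

Definition heavy (e : R) k a : set T :=
  [set t | H k0 a t /\ (e%:E <= P (cell k (code k a t) a))%E].

Lemma measurable_heavy e k a : measurable (heavy e k a).
Proof.
rewrite (_ : heavy e k a = \bigcup_m
    (if `[< e%:E <= P (cell k m a) >]%E then cell k m a else set0)).
  apply: bigcupT_measurable => m; case: asboolP => _ //; exact: measurable_cell.
apply/seteqP; split=> t /=.
  by case=> h he; exists (code k a t) => //; rewrite asboolT.
by case=> m _; case: asboolP => // h [cm hk]; split => //; rewrite cm.
Qed.

(** A point lying in every [heavy e k a] would have a type of measure at least
    e, by continuity of the measure along its decreasing cells. *)
Lemma heavy_cvg0 (e : R) (a : n.-tuple nat) : (0 < e)%R -> uniq a ->
  P (heavy e k a) @[k --> \oo] --> 0%E.
Proof.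
move=> e0 ua.
have sub k t : cell k.+1 (code k.+1 a t) a `<=` cell k (code k a t) a.
  by move=> t' [/codeS_inj[e1 _] h]; split.
have -> : 0%E = P (\bigcap_k heavy e k a).
  rewrite [X in P X](_ : _ = set0) ?measure0//; apply/seteqP; split=> // t h.
  have [h0 _] := h 0%N I.
  have tl : P (cell k (code k a t) a) @[k --> \oo] -->
      P (\bigcap_k cell k (code k a t) a).
    apply: nonincreasing_cvg_mu.
    - exact: (le_lt_trans (probability_le1 P (measurable_cell _ _ _)) (ltry _)).
    - by move=> k; exact: measurable_cell.
    - by apply: bigcapT_measurable => k; exact: measurable_cell.
    - by apply/nonincreasing_seqP => k; apply/subsetPset; exact: sub.
  have : (e%:E <= P (\bigcap_k cell k (code k a t) a))%E.
    rewrite -(cvg_lim _ tl)//; apply: lime_ge; first by apply/cvg_ex; eexists; exact: tl.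
    by apply: nearW => k; have [] := h k I.
  rewrite leNgt => /negP; apply.
  apply: (@le_lt_trans _ _ 0%E); last by rewrite lte_fin.
  rewrite -(nonatomic ua h0); apply: le_measure; rewrite ?inE.
  - by apply: bigcapT_measurable => k; exact: measurable_cell.
  - rewrite (_ : [set t' | _] = \bigcap_k (if `[< H k a t >] then H k a else ~` H k a)).
      by apply: bigcapT_measurable => k; case: asboolP => // _; exact: measurableC.
    apply/seteqP; split=> t' ht' k; have := ht' k; rewrite /=.
      by move=> hk _; case: asboolP => h1; [exact/hk|move/hk].
    by move/(_ I); case: asboolP => h1 h2; split.
  - move=> t' ht' k; have [] := ht' k.+1 I.
    by move=> /codeS_inj[].
apply: nonincreasing_cvg_mu.
- exact: (le_lt_trans (probability_le1 P (measurable_heavy _ _ _)) (ltry _)).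
- by move=> k; exact: measurable_heavy.
- by apply: bigcapT_measurable => k; exact: measurable_heavy.
- apply/nonincreasing_seqP => k; apply/subsetPset => t [h he]; split=> //.
  apply: (le_trans he); apply: le_measure; rewrite ?inE//; exact: measurable_cell.
Qed.

(** Outside the heavy cells, the probability that a and b fall in a common cell
    is at most the sum of the p ^ 2 <= e * p over cells of measure p < e. *)
Lemma disjoint_same_type_null (a b : n.-tuple nat) : uniq (a ++ b) ->
  P (same_type a b `&` H k0 a) = 0%E.
Proof.
move=> uab; have ua : uniq a by move: uab; rewrite cat_uniq => /andP[].
have mS : measurable (same_type a b `&` H k0 a).
  by apply: measurableI => //; exact: measurable_same_type.
apply/eqP; rewrite eq_le measure_ge0 andbT.
apply/lee_addgt0Pr => e' e'0; rewrite add0e; pose e := (e' / 2)%R.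
have e0 : (0 < e)%R by rewrite divr_gt0.
have [k hk] : exists k, (P (heavy e k a) <= e%:E)%E.
  have := heavy_cvg0 e0 ua => /fine_cvgP[_ /cvgr0Pnorm_le /(_ _ e0)[k _ /(_ k (leqnn k))] /=].
  rewrite ger0_norm ?fine_ge0// => h; exists k.
  by rewrite -[leLHS]fineK ?fin_num_measure// ?lee_fin//; exact: measurable_heavy.
pose A m := if `[< P (cell k m a) < e%:E >]%E then cell k m a `&` cell k m b else set0.
have mA m : measurable (A m).
  by rewrite /A; case: asboolP => // _; apply: measurableI; exact: measurable_cell.
have cover : same_type a b `&` H k0 a `<=` heavy e k a `|` \big[setU/set0]_(m < 2 ^ k) A m.
  move=> t [st h]; have [he|hl] := leP e%:E (P (cell k (code k a t) a)); [by left|right].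
  rewrite -bigcup_mkord; exists (code k a t); first exact: code_lt.
  rewrite /A asboolT//; split; split=> //; first by rewrite (eq_code _ st).
  exact/st.
have mB : measurable (\big[setU/set0]_(m < 2 ^ k) A m) by exact: bigsetU_measurable.
apply: (@le_trans _ _ (P (heavy e k a) + P (\big[setU/set0]_(m < 2 ^ k) A m))%E).
  apply: le_trans (measureU2 _ _ _) => //; last exact: measurable_heavy.
  by apply: le_measure; rewrite ?inE//; apply: measurableU => //; exact: measurable_heavy.
rewrite [e'](splitr e') EFinD; apply: leeD => //.
apply: (@le_trans _ _ (\sum_(m < 2 ^ k) P (A m))%E).
  by apply: content_subadditive.
apply: (@le_trans _ _ (\sum_(m < 2 ^ k) (e%:E * P (cell k m a)))%E).
  apply: lee_sum => m _; rewrite /A; case: asboolP => hm; last first.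
    by rewrite measure0 mule_ge0// lee_fin ltW.
  have mI : measurable (cell k m a `&` cell k m b).
    by apply: measurableI; exact: measurable_cell.
  have mc := measurable_cell k m a.
  rewrite -[leLHS]fineK ?fin_num_measure// -[P (cell k m a)]fineK ?fin_num_measure//.
  rewrite -EFinM lee_fin.
  apply: (le_trans (disjoint_le_sq (measurable_cell k m) (@equivariant_cell k m) uab)).
  rewrite ler_wpM2r ?fine_ge0// -lee_fin fineK ?fin_num_measure//.
  exact: ltW.
rewrite -ge0_sume_distrr//.
rewrite -[leRHS]mule1; apply: lee_wpmul2l; first by rewrite lee_fin ltW.
rewrite -(@measure_bigsetU _ _ _ P (fun m => cell k m a)).
- apply: probability_le1; apply: bigsetU_measurable => m _; exact: measurable_cell.
- by move=> m; exact: measurable_cell.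
- apply/trivIsetP => i j _ _ ij; apply/seteqP; split => // t [[/= ei _] [/= ej _]].
  by rewrite -ei -ej eqxx in ij.
Qed.

(** ** Recurrence *)

Lemma act_same_type f g a b : cancel f g -> cancel g f ->
  act f @^-1` same_type a b = same_type (map_tuple f a) (map_tuple f b).
Proof.
move=> fK gK; apply/seteqP; split=> t h k; have := h k.
  by rewrite -!(equivariant_H k fK gK).
by rewrite -!(equivariant_H k fK gK).
Qed.

Definition shift_off (a : seq nat) m y := if y \in a then y else (y + m)%N.

(** The involution exchanging each entry y of b outside a with y + m.  For m a
    large multiple of a bound K on the entries, it fixes a and every other
    shifted copy of b. *)
Definition swap_petal (a b : seq nat) m y :=
  let pet z := (z \in b) && (z \notin a) in
  if pet y then (y + m)%N else if (m <= y)%N && pet (y - m)%N then (y - m)%N else y.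

Section Swap.
Variables (a b : seq nat) (K : nat).
Hypotheses (aK : forall y, y \in a -> (y < K)%N) (bK : forall y, y \in b -> (y < K)%N).

Lemma swap_petalK i : involutive (swap_petal a b (i * K)).
Proof.
move=> y; rewrite /swap_petal.
case: (boolP ((y \in b) && (y \notin a))) => [py|npy].
  case: i => [|i]; first by rewrite mul0n !addn0 py.
  rewrite leq_addl addnK py; case: andP => // -[/bK h _]; exfalso.
  by move: h; rewrite mulSn; lia.
case: (boolP [&& i * K <= y, y - i * K \in b & y - i * K \notin a]%N) => h.
  by case/andP: h => my py; rewrite py subnK.
by rewrite (negbTE npy) (negbTE h).
Qed.

Lemma swap_petal_fix i : map (swap_petal a b (i * K)) a = a.
Proof.
rewrite -[RHS]map_id; apply/eq_in_map => y ya; rewrite /swap_petal ya andbF.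
case: i => [|i]; first by rewrite mul0n subn0 ya andbF andbF.
by case: ifP => // /andP[h _]; have := aK ya; move: h; rewrite mulSn; lia.
Qed.

Lemma swap_petal_move i : map (swap_petal a b (i * K)) b = map (shift_off a (i * K)) b.
Proof.
apply/eq_in_map => y yb; rewrite /swap_petal /shift_off yb /=.
case: (boolP (y \in a)) => //= ya; case: ifP => // /andP[h _].
case: i h => [|i] h; first by rewrite mul0n subn0.
by have := aK ya; move: h; rewrite mulSn; lia.
Qed.

Lemma swap_petal_other i j : j != 0%N -> j != i ->
  map (swap_petal a b (i * K)) (map (shift_off a (j * K)) b) =
  map (shift_off a (j * K)) b.
Proof.
move=> j0 ji; rewrite -[RHS]map_id; apply/eq_in_map => _ /mapP[y yb ->].
rewrite /shift_off; case: (boolP (y \in a)) => ya.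
  by have /eq_in_map /(_ y ya) := etrans (swap_petal_fix i) (esym (map_id a)).
rewrite /swap_petal; case: ifP => [/andP[/bK h _]|_].
  by exfalso; move: h; case: j j0 ji => // j _ _; rewrite mulSn; lia.
case: ifP => // /andP[h1 /andP[/bK h2 _]]; exfalso.
have yK := bK yb; move: h1 h2.
case: (ltngtP j i) => [lt|gt|e]; last by rewrite e eqxx in ji.
- by have := leq_mul2r K j.+1 i; rewrite lt orbT mulSn; lia.
- by have := leq_mul2r K i.+1 j; rewrite gt orbT mulSn; lia.
Qed.
End Swap.

(** In the proof, E N says that among b and its first N shifted copies only b has
    the type of a.  Its image Q N i under the i-th swap says so of the i-th copy;
    these images are disjoint and equally likely, so P (E N) <= 1 / (N + 1). *)
Lemma recurrence_null (a b : n.-tuple nat) K :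
  P.-negligible [set t | same_type a b t /\
    forall b' : n.-tuple nat,
      (forall y, y \in b' -> (y < K)%N -> (y \in a) && (y \in b)) ->
      ~ same_type a b' t].
Proof.
pose K' := (\sum_(y <- a ++ b) y + K).+1.
have le_sum (s : seq nat) y : y \in s -> (y <= \sum_(z <- s) z)%N.
  by move=> ys; rewrite (big_rem y)//= leq_addr.
have aK y : y \in a -> (y < K')%N.
  by move=> ya; rewrite ltnS (leq_trans (le_sum (a ++ b) y _)) ?leq_addr// mem_cat ya.
have bK y : y \in b -> (y < K')%N.
  by move=> yb; rewrite ltnS (leq_trans (le_sum (a ++ b) y _)) ?leq_addr// mem_cat yb orbT.
pose c i := map_tuple (shift_off a (i * K')) b.
pose E N := same_type a b `&` \bigcap_(j in [set j | (0 < j <= N)%N]) ~` same_type a (c j).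
have mE N : measurable (E N).
  apply: measurableI; first exact: measurable_same_type.
  apply: bigcap_measurableType => j _.
  by apply: measurableC; exact: measurable_same_type.
have c0 : c 0%N = b.
  apply/val_inj; rewrite /= -[RHS]map_id; apply/eq_in_map => y _.
  by rewrite /shift_off mul0n addn0 if_same.
pose sw i := swap_petal a b (i * K').
have swK i : involutive (sw i) by exact: swap_petalK.
pose Q N i := act (sw i) @^-1` E N.
have PQ N i : P (Q N i) = P (E N).
  by apply: (act_preserving (swK i) (swK i)).
have QE N i t : Q N i t -> same_type a (c i) t /\
    forall j, (0 < j <= N)%N -> ~ same_type a (c (if j == i then 0%N else j)) t.
  rewrite /Q /E preimage_setI (act_same_type _ _ (swK i) (swK i)).
  have -> : map_tuple (sw i) a = a by apply/val_inj; exact: swap_petal_fix.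
  have -> : map_tuple (sw i) b = c i by apply/val_inj; exact: swap_petal_move.
  case=> h1 h2; split=> // j jN; have := h2 j jN.
  rewrite /= -[same_type a (c j) _]/((act (sw i) @^-1` same_type a (c j)) t).
  rewrite (act_same_type _ _ (swK i) (swK i)).
  have -> : map_tuple (sw i) a = a by apply/val_inj; exact: swap_petal_fix.
  rewrite (_ : map_tuple (sw i) (c j) = c (if j == i then 0%N else j))//.
  apply/val_inj => /=; case: eqP => [->|/eqP ji]; last first.
    by apply: swap_petal_other => //; rewrite -lt0n; case/andP: jN.
  rewrite -/(c i) -[RHS]/(tval (c 0%N)) c0 -(@swap_petal_move a b K' aK i) -map_comp.
  by rewrite -[RHS]map_id; apply: eq_map => y /=; exact: swK.
have small N : (N.+1%:R * fine (P (E N)) <= 1)%R.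
  rewrite -lee_fin EFinM fineK ?fin_num_measure//.
  apply: (@le_trans _ _ (\sum_(i < N.+1) P (Q N i))%E).
    rewrite (eq_bigr (fun=> P (E N))); last by move=> i _; exact: PQ.
    rewrite -[P (E N)]fineK ?fin_num_measure// -EFinM sumEFin.
    by rewrite sumr_const card_ord mulr_natl.
  rewrite -measure_bigsetU_ord => [|i|].
  - apply: probability_le1; apply: bigsetU_measurable => i _; exact: measurable_act.
  - exact: measurable_act.
  - apply/trivIsetP => i j _ _ ij; apply/seteqP; split=> // t [/QE[hi ni] /QE[hj nj]].
    (* the j-th swap exchanges b with its j-th copy, so Q N j excludes b as well
       as the copies other than the j-th *)
    case: (posnP i) => [i0|ip].
      have jp : (0 < j <= N)%N.
        rewrite lt0n -[(j <= N)%N]ltnS ltn_ord andbT.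
        by apply: contra ij => /eqP j0; apply/eqP/val_inj; rewrite /= i0 j0.
      by apply: (nj j jp); rewrite eqxx -i0.
    apply: (nj i); first by rewrite ip -[(i <= N)%N]ltnS ltn_ord.
    by move: ij; rewrite -val_eqE => /negbTE ->.
exists (\bigcap_N E N); split.
- by apply: bigcapT_measurable.
- apply/eqP; rewrite eq_le measure_ge0 andbT.
  have mI : measurable (\bigcap_N E N) by exact: bigcapT_measurable.
  rewrite -[leLHS]fineK ?fin_num_measure// lee_fin leNgt; apply/negP => p0.
  have [N hN] : exists N, ((fine (P (\bigcap_N E N)))^-1 < N.+1%:R)%R.
    exists (Num.truncn (fine (P (\bigcap_N E N)))^-1).
    exact: truncnS_gt.
  have := small N; apply/negP; rewrite -ltNge.
  apply: (@lt_le_trans _ _ (N.+1%:R * fine (P (\bigcap_N E N))))%R.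
    by rewrite -ltr_pdivrMr// div1r.
  rewrite ler_wpM2l// fine_le ?fin_num_measure//.
  by apply: le_measure; rewrite ?inE//; exact: bigcap_inf.
- move=> t [ab h] N _; split=> // j /andP[j0 _]; apply: h => y /mapP[z zb ->] yK.
  move: yK; rewrite /shift_off; case: (boolP (z \in a)) => [za _|za]; first by rewrite za.
  by case: j j0 => // j _; rewrite mulSn /K'; lia.
Qed.

(** ** A common entry *)

(** Choose a pair (a, b) in S with the fewest common entries.  Recurrence beyond
    all entries of a tuple e in S yields b' in S whose entries in common with e
    are common to a and b; by minimality there are no fewer of them, so e
    contains every entry common to a and b. *)
Lemma common_entry (S : n.-tuple nat -> Prop) (a0 : n.-tuple nat) : S a0 ->
  (forall a : n.-tuple nat, S a -> uniq a) ->
  (forall a b : n.-tuple nat, S a -> S b -> has (mem b) a) ->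
  (forall (a b : n.-tuple nat) K, S a -> S b -> exists2 b' : n.-tuple nat, S b' &
    forall y, y \in b' -> (y < K)%N -> (y \in a) && (y \in b)) ->
  exists c, forall b : n.-tuple nat, S b -> c \in b.
Proof.
move=> Sa0 uS meet recur.
pose overlap m := `[< exists a b : n.-tuple nat, [/\ S a, S b & count (mem b) a = m] >].
have ex : exists m, overlap m by exists (count (mem a0) a0); apply/asboolP; exists a0, a0.
case: (ex_minnP ex) => m /asboolP[a [b [Sa Sb ab]]] minm.
have /hasP[c ca cb] := meet a b Sa Sb.
exists c => e Se; apply/negPn/negP => ce.
(* the sum of the entries of e serves as an upper bound for each of them *)
have [b' Sb' hb'] := recur a b (\sum_(y <- e) y).+1 Sa Sb.
have : (count (mem b) a <= count (mem b') e)%N.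
  by rewrite ab; apply: minm; apply/asboolP; exists e, b'.
rewrite -!size_filter leqNgt => /negP; apply.
apply: (@uniq_leq_size _ (c :: seq.filter (mem b') e)).
  by rewrite /= mem_filter (negbTE ce) andbF filter_uniq// uS.
move=> y; rewrite inE !mem_filter => /predU1P[->|/andP[yb' ye]].
  by apply/andP; split.
rewrite andbC; apply: hb' => //; rewrite ltnS.
by rewrite (big_rem y)//= leq_addr.
Qed.

Lemma ae_forall_countable (I : countType) (Q : I -> T -> Prop) :
  (forall i, {ae P, forall t, Q i t}) -> {ae P, forall t, forall i, Q i t}.
Proof.
move=> hQ.
have /ae_foralln : forall k, {ae P, forall t,
    if @choice.unpickle I k is Some i then Q i t else True}.
  by move=> k; case: choice.unpickle => [i|]; [exact: hQ|exact: aeW].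
by apply: filterS => t h i; have := h (choice.pickle i); rewrite choice.pickleK.
Qed.

Lemma ae_common_entry : {ae P, forall t (a : n.-tuple nat), H k0 a t ->
  (forall b, same_type a b t -> uniq b) ->
  exists c, forall b : n.-tuple nat, same_type a b t -> c \in b}.
Proof.
have h1 : {ae P, forall t (ab : n.-tuple nat * n.-tuple nat),
    uniq (ab.1 ++ ab.2) -> ~ (same_type ab.1 ab.2 t /\ H k0 ab.1 t)}.
  apply: ae_forall_countable => -[a b] /=.
  have [u|nu] := boolP (uniq (a ++ b)); last by apply: aeW.
  exists (same_type a b `&` H k0 a); split => //.
  - by apply: measurableI => //; exact: measurable_same_type.
  - exact: disjoint_same_type_null.
  - by move=> t /= /not_implyP[_ /contrapT].
have h2 : {ae P, forall t (abK : n.-tuple nat * n.-tuple nat * nat),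
    same_type abK.1.1 abK.1.2 t -> exists2 b' : n.-tuple nat,
      forall y, y \in b' -> (y < abK.2)%N -> (y \in abK.1.1) && (y \in abK.1.2) &
      same_type abK.1.1 b' t}.
  apply: ae_forall_countable => -[[a b] K] /=.
  apply: negligibleS (recurrence_null a b K) => t /= /not_implyP[st h]; split=> // b' hb' sb'.
  by apply: h; exists b'.
apply: filterS2 h1 h2 => t dj rc a ha ua.
have trans b b' : same_type a b t -> same_type a b' t -> same_type b b' t.
  by move=> h h' k; rewrite -(h k) -(h' k).
apply: (@common_entry (fun b => same_type a b t) a) => //.
- move=> b b' sb sb'; apply: contrapT => nh.
  apply: (dj (b, b')) => /=.
    rewrite cat_uniq !ua//= andbT; apply/hasPn => y yb'; apply/negP => yb.
    by apply: nh; apply/hasP; exists y.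
  by split; [exact: trans|apply/(sb k0)].
- move=> b b' K sb sb'; have [b2 h hs] := rc (b, b', K) (trans _ _ sb sb').
  by exists b2 => // k; rewrite (sb k) (hs k).
Qed.
End ExchangeableTypes.

(** * The logic action and the measurability of satisfaction *)

Section Pull.
Variable L : language.

(** For a permutation f this is the logic action of the inverse of f, so that a
    realizes phi in [pull f M] iff the image of a under f does in M. *)
Definition pull (f : nat -> nat) (M : Str L) : Str L :=
  fun Q t => M Q (map_tuple f t).

Lemma Str_ext (M N : Str L) : (forall Q t, M Q t <-> N Q t) -> M = N.
Proof.
by move=> h; apply: functional_extensionality_dep => Q; apply/funext => t; exact/propext.
Qed.

Lemma pull_comp f g M : pull f (pull g M) = pull (g \o f) M.
Proof.
apply: Str_ext => Q t; rewrite /pull.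
by rewrite (_ : map_tuple g _ = map_tuple (g \o f) t)//; apply/val_inj; rewrite /= map_comp.
Qed.

Lemma pull_id f M : f =1 id -> pull f M = M.
Proof.
move=> fid; apply: Str_ext => Q t; rewrite /pull.
by rewrite (_ : map_tuple f t = t)//; apply/val_inj; rewrite /= map_id_in.
Qed.

Lemma open_subbase (S : set (Str L)) : Str_subbase S -> open S.
Proof.
move=> hS; exists [set S]; last by rewrite bigcup_set1.
move=> _ ->; exists [fset S]%fset.
  by move=> B /fset1P ->; exact/mem_set.
apply/seteqP; split => [M h|M SM B /= /fset1P -> //].
by apply: h; exact/fset1P.
Qed.

Lemma open_pull f (U : set (Str L)) : open U -> open (pull f @^-1` U).
Proof.
case=> D' sD' <-; rewrite preimage_bigcup; apply: bigcup_open => A /sD'[E sE <-].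
rewrite preimage_bigcap bigcap_fset big_seq.
apply: (big_ind (fun X : set (Str L) => open X)); [exact: openT|exact: openI|].
move=> B BE; apply: open_subbase.
have /set_mem[Q [t BQ]] := sE B BE.
exists Q, (map_tuple f t).
by case: BQ => ->; [left|right].
Qed.

Lemma measurable_rel Q (t : (arity Q).-tuple nat) : measurable [set M : Str L | M Q t].
Proof.
apply: sub_sigma_algebra; apply: open_subbase.
by exists Q, t; left.
Qed.

Lemma measurable_pull f (X : set (Str L)) : measurable X -> measurable (pull f @^-1` X).
Proof.
pose G := [set X : set (Str L) | measurable (pull f @^-1` X)].
suff : <<s open >> `<=` G by apply.
apply: smallest_sub.
  split; rewrite /G/=.
  - by rewrite preimage_set0.
  - by move=> A mA; rewrite setTD preimage_setC; exact: measurableC.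
  - by move=> A mA; rewrite preimage_bigcup; exact: bigcupT_measurable.
by move=> U oU; apply: sub_sigma_algebra; exact: open_pull.
Qed.

Lemma measurable_sat v (phi : formula L) : measurable [set M : Str L | sat M v phi].
Proof.
elim: phi v => /=.
- by move=> v; rewrite [X in measurable X](_ : _ = setT)//; apply/seteqP; split.
- by move=> v; rewrite [X in measurable X](_ : _ = set0)//; apply/seteqP; split.
- by move=> Q t v; exact: measurable_rel.
- move=> i j v; have [e|ne] := pselect (v i = v j).
    by rewrite [X in measurable X](_ : _ = setT)//; apply/seteqP; split.
  by rewrite [X in measurable X](_ : _ = set0)//; apply/seteqP; split.
- by move=> psi IH v; exact: (measurableC (IH v)).
- by move=> p IHp q IHq v; exact: (measurableI _ _ (IHp v) (IHq v)).
- by move=> p IHp q IHq v; exact: (measurableU _ _ (IHp v) (IHq v)).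
- move=> i psi IH v.
  rewrite [X in measurable X](_ : _ = \bigcap_c [set M : Str L | sat M (update v i c) psi]).
    by apply: bigcapT_measurable => c; exact: IH.
  by apply/seteqP; split=> M h c; [move=> _; exact: h|exact: (h c I)].
- move=> i psi IH v.
  rewrite [X in measurable X](_ : _ = \bigcup_c [set M : Str L | sat M (update v i c) psi]).
    by apply: bigcupT_measurable => c; exact: IH.
  by apply/seteqP; split=> M [c]; [exists c|move=> _; exists c].
- move=> g IH v.
  rewrite [X in measurable X](_ : _ = \bigcap_k [set M : Str L | sat M v (g k)]).
    by apply: bigcapT_measurable => c; exact: IH.
  by apply/seteqP; split=> M h c; [move=> _; exact: h|exact: (h c I)].
- move=> g IH v.
  rewrite [X in measurable X](_ : _ = \bigcup_k [set M : Str L | sat M v (g k)]).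
    by apply: bigcupT_measurable => c; exact: IH.
  by apply/seteqP; split=> M [c]; [exists c|move=> _; exists c].
Qed.

End Pull.

Lemma sat_ext (L : language) (T : Type) (M : structure L T) (phi : formula L) v w :
  (forall i, free_vars phi i -> v i = w i) -> sat M v phi <-> sat M w phi.
Proof.
elim: phi v w => //=.
- move=> Q t v w h; rewrite (_ : map_tuple v t = map_tuple w t)//.
  by apply/val_inj => /=; apply/eq_in_map => i it; exact: h.
- by move=> i j v w h; rewrite (h i) ?(h j)//; [right|left].
- by move=> p IH v w h; have [] := IH _ _ h; split; apply: contra_not.
- move=> p IHp q IHq v w h.
  have [] := IHp v w (fun i fi => h i (or_introl fi)).
  by have [] := IHq v w (fun i fi => h i (or_intror fi)); tauto.
- move=> p IHp q IHq v w h.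
  have [] := IHp v w (fun i fi => h i (or_introl fi)).
  by have [] := IHq v w (fun i fi => h i (or_intror fi)); tauto.
- move=> i p IH v w h.
  have hu c j : free_vars p j -> update v i c j = update w i c j.
    by rewrite /update; case: eqP => // ji fj; apply: h; split.
  by split=> H c; have [] := IH _ _ (hu c); have := H c; tauto.
- move=> i p IH v w h.
  have hu c j : free_vars p j -> update v i c j = update w i c j.
    by rewrite /update; case: eqP => // ji fj; apply: h; split.
  by split=> -[c H]; exists c; have [] := IH _ _ (hu c); tauto.
- move=> g IH v w h.
  have hg k i : free_vars (g k) i -> v i = w i by move=> ?; apply: h; exists k.
  by split=> H k; have [] := IH k _ _ (hg k); have := H k; tauto.
- move=> g IH v w h.
  have hg k i : free_vars (g k) i -> v i = w i by move=> ?; apply: h; exists k.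
  by split=> -[k H]; exists k; have [] := IH k _ _ (hg k); tauto.
Qed.

Lemma sat_pull (L : language) (M : Str L) f g v (phi : formula L) :
  cancel f g -> cancel g f ->
  sat (pull f M) v phi <-> sat M (f \o v) phi.
Proof.
move=> fK gK.
have up u i c : f \o update u i c = update (f \o u) i (f c).
  by apply/funext => j; rewrite /update/=; case: eqP.
elim: phi v => //=.
- move=> Q t v; rewrite /pull (_ : map_tuple f _ = map_tuple (f \o v) t)//.
  by apply/val_inj; rewrite /= map_comp.
- by move=> i j v; split=> [->//|/(can_inj fK)].
- by move=> p IH v; have [] := IH v; split; apply: contra_not.
- by move=> p IHp q IHq v; have [] := IHp v; have [] := IHq v; tauto.
- by move=> p IHp q IHq v; have [] := IHp v; have [] := IHq v; tauto.
- move=> i p IH v; split=> H c; last by apply/IH; rewrite up; exact: H.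
  by have := H (g c); move/IH; rewrite up gK.
- move=> i p IH v; split=> -[c H]; first by exists (f c); move/IH: H; rewrite up.
  by exists (g c); apply/IH; rewrite up gK.
- by move=> h IH v; split=> H k; have := H k; move/IH.
- by move=> h IH v; split=> -[k /IH H]; exists k.
Qed.

Section LogicAction.
Variable L : language.

Lemma logic_action_image (s : Sym_nat) (X : set (Str L)) :
  logic_action s @` X = pull s @^-1` X.
Proof.
have sK : cancel s s^-1%FUN by move=> z; rewrite funK ?inE.
have sVK : cancel s^-1%FUN s by move=> z; rewrite invK ?inE.
apply/seteqP; split=> [_ [M XM <-]|M XM].
  rewrite /preimage/= (_ : logic_action s M = pull s^-1%FUN M)//.
  by rewrite pull_comp pull_id.
exists (pull s M) => //; rewrite (_ : logic_action s _ = pull s^-1%FUN (pull s M))//.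
by rewrite pull_comp pull_id.
Qed.

Variables (R : realType) (mu : probability (Str L) R).

Lemma invariant_pull : Defs.invariant mu -> forall f g,
  cancel f g -> cancel g f -> forall X, measurable X -> mu (pull f @^-1` X) = mu X.
Proof.
move=> imu f g fK gK X mX.
have [s ->] := PbijTT (Bijective fK gK).
by rewrite -logic_action_image imu.
Qed.

Lemma ergodic_pull : ergodic mu -> forall X, measurable X ->
  (forall f g, cancel f g -> cancel g f -> mu (X `+` pull f @^-1` X) = 0%E) ->
  mu X = 0%E \/ mu X = 1%E.
Proof.
move=> emu X mX h; apply: emu => // s; rewrite logic_action_image.
by apply: (h _ s^-1%FUN) => z; rewrite ?funK ?invK ?inE.
Qed.
End LogicAction.

(** * Rooted models *)

Lemma enumeration_of (T : Type) (A : set T) : countable A -> A !=set0 ->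
  exists e : nat -> T, range e = A.
Proof.
move=> /pfcard_geP[->|[e] _]; first by case.
exists e; apply/seteqP; split=> [_ [k _ <-]|y Ay]; first exact: funS.
by have [k _ <-] := @surj _ _ _ _ e y Ay; exists k.
Qed.

Section CountableQuantifiers.
Context {d : measure_display} {T : measurableType d}.

Lemma measurable_forall (I : countType) (Q : I -> T -> Prop) :
  (forall i, measurable [set t | Q i t]) -> measurable [set t | forall i, Q i t].
Proof.
move=> mQ; rewrite (_ : [set t | _] = ~` \bigcup_i ~` [set t | Q i t]).
  apply: measurableC; apply: countable_bigcupT_measurable => // i.
  exact: measurableC.
apply/seteqP; split=> t /= h; first by case=> i _; apply.
by move=> i; apply: contrapT => nq; apply: h; exists i.
Qed.

Lemma measurable_exists (I : countType) (Q : I -> T -> Prop) :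
  (forall i, measurable [set t | Q i t]) -> measurable [set t | exists i, Q i t].
Proof.
move=> mQ; rewrite (_ : [set t | _] = \bigcup_i [set t | Q i t]).
  exact: countable_bigcupT_measurable.
by apply/seteqP; split=> t [i]; [move=> qi; exists i|move=> _ qi; exists i].
Qed.

Lemma measurable_imply (A : Prop) (Q : T -> Prop) :
  measurable [set t | Q t] -> measurable [set t | A -> Q t].
Proof.
move=> mQ; have [a|na] := pselect A.
  by rewrite (_ : [set t | _] = [set t | Q t])//; apply/seteqP; split=> t //=; apply.
by rewrite (_ : [set t | _] = setT)//; apply/seteqP; split=> t // _ /na.
Qed.
End CountableQuantifiers.

Section Distinct.
Variables (L : language) (T : Type) (M : structure L T).

(** Instantiating every quantified variable by its own value. *)
Lemma sat_closure v (s : seq nat) (phi : formula L) :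
  sat M v (foldr (@fAll L) phi s) -> sat M v phi.
Proof.
elim: s => //= i s IH /(_ (v i)); rewrite (_ : update v i (v i) = v)//.
by apply/funext => j; rewrite /update; case: eqP => [->|].
Qed.

Lemma sat_conj_neq v (ps : seq (nat * nat)) :
  sat M v (foldr (@fAnd L) fTrue [seq fNot (fEq p.1 p.2) | p <- ps]) ->
  forall p, p \in ps -> v p.1 <> v p.2.
Proof.
elim: ps => //= p ps IH [hp hps] q; rewrite inE => /predU1P[->//|].
exact: IH.
Qed.

Lemma sat_distinct_formula v (s : seq nat) : sat M v (distinct_formula L s) ->
  forall i j, i \in s -> j \in s -> i != j -> v i <> v j.
Proof.
move=> h i j si sj ij; apply: (sat_conj_neq h (p := (i, j))).
by rewrite mem_filter ij; apply/allpairsP; exists (i, j).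
Qed.
End Distinct.

Section Types.
Variables (L : language) (n : nat) (x : n.-tuple nat).

Lemma sat_at_pull f g (M : Str L) (a : n.-tuple nat) (phi : formula L) :
  cancel f g -> cancel g f -> free_vars phi `<=` [set` x] ->
  sat_at (pull f M) x a phi <-> sat_at M x (map_tuple f a) phi.
Proof.
move=> fK gK fx; rewrite /sat_at (sat_pull _ _ _ fK gK); apply: sat_ext => i /fx /= ix.
by rewrite (nth_map point)//; move: ix; rewrite -index_mem !size_tuple.
Qed.

Lemma realization_uniq (M : Str L) (b : n.-tuple nat) chi : uniq x ->
  models M (chi_distinct x chi) -> sat_at M x b chi -> uniq b.
Proof.
move=> ux hM hb; have /sat_closure := hM (fun i => nth point b (index i x)).
case=> // /sat_distinct_formula hd; apply/(uniqP point) => i j.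
rewrite !inE !size_tuple => iN jN e; apply: contrapT => ij.
apply: (hd (nth 0%N x i) (nth 0%N x j)).
- by rewrite mem_nth// size_tuple.
- by rewrite mem_nth// size_tuple.
- by rewrite nth_uniq ?size_tuple//; exact/eqP.
- by rewrite !index_uniq ?size_tuple.
Qed.
End Types.

Section Theories.
Variables (L : language) (R : realType) (mu : probability (Str L) R).

Lemma modelsE (phi : formula L) : sentence phi ->
  [set M : Str L | models M phi] = [set M | sat M (fun=> 0%N) phi].
Proof.
move=> sphi; apply/seteqP; split=> M /= h; first exact: h.
move=> v; suff [_] : sat M v phi <-> sat M (fun=> 0%N) phi by apply.
by apply: sat_ext; rewrite sphi.
Qed.

Lemma measurable_models (phi : formula L) : sentence phi ->
  measurable [set M : Str L | models M phi].
Proof. by move=> sphi; rewrite modelsE//; exact: measurable_sat. Qed.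

Lemma models_theoryE (F : set (formula L)) (e : nat -> formula L) : range e = F ->
  [set M : Str L | forall phi, theory F mu phi -> models M phi] =
  [set M : Str L | forall k, theory F mu (e k) -> models M (e k)].
Proof.
move=> eF; apply/seteqP; split=> M /= h; first by move=> k tk; exact: h.
move=> phi tphi; have : F phi by case: tphi.
by rewrite -eF => -[k _ ek]; move: tphi; rewrite -ek; exact: h.
Qed.

Lemma measurable_models_theory (F : set (formula L)) : countable F -> F !=set0 ->
  measurable [set M : Str L | forall phi, theory F mu phi -> models M phi].
Proof.
move=> cF F0; have [e eF] := enumeration_of cF F0; rewrite (models_theoryE eF).
apply: measurable_forall => k.
have [sk|nk] := pselect (sentence (e k)).
  by apply: measurable_imply; exact: measurable_models.
by rewrite (_ : [set t | _] = setT)//; apply/seteqP; split=> // M _ [_ /nk].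
Qed.

Lemma ae_models_theory (F : set (formula L)) : countable F -> F !=set0 ->
  {ae mu, forall M : Str L, forall phi, theory F mu phi -> models M phi}.
Proof.
move=> cF F0; have [e eF] := enumeration_of cF F0.
have FF : Filter (almost_everywhere mu) by exact: ae_filter_ringOfSetsType.
suff : {ae mu, forall M k, theory F mu (e k) -> models M (e k)}.
  apply: filterS => M h; suff : [set M : Str L | forall k,
    theory F mu (e k) -> models M (e k)] M by rewrite -(models_theoryE eF).
  exact: h.
apply: ae_forall_countable => k.
have [tk|nk] := pselect (theory F mu (e k)); last by apply: aeW.
have [_ sk mu1] := tk; exists (~` [set M : Str L | models M (e k)]); split.
- by apply: measurableC; exact: measurable_models.
- by rewrite probability_setC ?mu1 ?subee//; exact: measurable_models.
- by move=> M /= /not_implyP[].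
Qed.
End Theories.

Local Open Scope ereal_scope.

Theorem theorem5p5 (R : realType) (L : language) (mu : probability (Str L) R)
    (F : set (formula L)) (n : nat) (x : n.-tuple nat) (chi : formula L) :
  properly_ergodic mu ->
  fragment F -> countable F ->
  uniq x -> F chi -> free_vars chi `<=` [set` x] ->
  0 < mu_formula mu x chi ->
  theory F mu (chi_distinct x chi) ->
  (forall p : set (formula L), is_type F x p -> p chi -> mu_type mu x p = 0) ->
  measurable (chi_rooted_models F (theory F mu) x chi) /\
  mu (chi_rooted_models F (theory F mu) x chi) = 1.
Proof.
move=> [[imu emu] _] fragF cF ux Fchi chix _ Thd nonatomic.
(* the types in the variables x are decided by the properties [e k] *)
pose G := [set psi : formula L | F psi /\ free_vars psi `<=` [set` x]].
have [e eG] : exists e : nat -> formula L, range e = G.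
  apply: enumeration_of; first by apply: sub_countable cF; apply: subset_card_le => psi [].
  by exists chi.
have Ge k : G (e k) by rewrite -eG; exists k.
have [k0 ek0] : exists k, e k = chi.
  by have : G chi by []; rewrite -eG => -[k _ <-]; exists k.
pose H k (a : n.-tuple nat) := [set M : Str L | sat_at M x a (e k)].
have mH k a : measurable (H k a) by exact: measurable_sat.
have eH k : equivariant (@pull L) (H k).
  move=> f g fK gK a; apply/seteqP; split=> M /=.
    by move/(sat_at_pull M a fK gK (Ge k).2).
  by move=> h; apply/(sat_at_pull M a fK gK (Ge k).2).
have same_typeP a b M : type_of F M x a = type_of F M x b <-> same_type H a b M.
  split=> [h k|h].
    have := congr1 (fun p => p (e k)) h; rewrite /type_of/= => h1.
    have [Fk xk] := Ge k; split=> hk.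
      suff [] : [/\ F (e k), free_vars (e k) `<=` [set` x] & sat_at M x b (e k)] by [].
      by rewrite -h1.
    suff [] : [/\ F (e k), free_vars (e k) `<=` [set` x] & sat_at M x a (e k)] by [].
    by rewrite h1.
  apply/seteqP; split=> psi [Fp xp hp]; split=> //; have : G psi by [];
  by rewrite -eG => -[k _ ek]; move: hp; rewrite -ek; case: (h k).
(* invariance moves the hypothesis on types from the tuple (0, ..., n-1) to a *)
have nonat (a : n.-tuple nat) M : uniq a -> H k0 a M ->
    mu [set M' | forall k, H k a M' <-> H k a M] = 0.
  move=> ua hM.
  pose E b := [set M' : Str L | forall k, H k b M' <-> H k a M].
  have mE b : measurable (E b).
    apply: measurable_forall => k.
    have [h|nh] := pselect (H k a M).
      rewrite (_ : [set M' | _] = H k b)//; apply/seteqP; split=> M' /=; tauto.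
    rewrite (_ : [set M' | _] = ~` H k b); first exact: measurableC.
    by apply/seteqP; split=> M' /=; tauto.
  have eE : equivariant (@pull L) E.
    move=> f g fK gK b; apply/seteqP; split=> M' /= h k; have := h k;
    by rewrite -(eH k f g fK gK).
  have u0 : uniq (iota_tuple n 0) by exact: iota_uniq.
  rewrite -/(E a) (equivariant_measure (invariant_pull imu) mE eE ua u0).
  pose p := type_of F M x a.
  have pchi : p chi by split => //; rewrite -ek0.
  have := nonatomic p (ex_intro _ _ (ex_intro _ M (ex_intro _ a erefl))) pchi.
  rewrite /mu_type => h0; apply/eqP; rewrite eq_le measure_ge0 andbT -h0.
  apply: le_measure; rewrite ?inE//.
    rewrite (_ : [set M' | _] = [set M' | forall k, p (e k) -> H k (iota_tuple n 0) M']).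
      by apply: measurable_forall => k; apply: measurable_imply; exact: mH.
    apply/seteqP; split=> M' /= h; first by move=> k pk; exact: h.
    move=> psi ppsi; have : G psi by case: ppsi.
    by rewrite -eG => -[k _ ek]; move: ppsi; rewrite -ek; exact: h.
  move=> M' hM' psi [Fp xp hp]; have : G psi by [].
  by rewrite -eG => -[k _ ek]; move: hp; rewrite -ek => hp; apply/(hM' k).
(* a type is mentioned only through the tuples realizing it in M, so that the
   quantifiers range over countable sets *)
have rootedE : chi_rooted_models F (theory F mu) x chi =
    [set M | forall phi, theory F mu phi -> models M phi] `&`
    [set M | forall a, H k0 a M -> exists c, forall b : n.-tuple nat,
      same_type H a b M -> c \in b].
  apply/seteqP; split=> M [hT hr]; split=> //.
    move=> a ha; pose p := type_of F M x a.
    have [||| c hc] := hr p; first by exists (nat : pointedType), M, a.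
    - by split => //; rewrite -ek0.
    - by exists a.
    by exists c => b /same_typeP hb; apply: hc; rewrite /realizes -hb.
  move=> p _ pchi [a pa]; have [|c hc] := hr a.
    by move: pchi; rewrite pa /H/= ek0 => -[].
  by exists c => b pb; apply: hc; apply/same_typeP; rewrite -pa.
have F0 : F !=set0 by exists chi.
have mT := measurable_models_theory mu cF F0.
have mB : measurable [set M : Str L | forall a, H k0 a M -> exists c,
    forall b : n.-tuple nat, same_type H a b M -> c \in b].
  apply: measurable_forall => a.
  have mR : measurable [set M : Str L | exists c,
      forall b : n.-tuple nat, same_type H a b M -> c \in b].
    apply: measurable_exists => c; apply: measurable_forall => b.
    have [cb|ncb] := boolP (c \in b).
      by rewrite (_ : [set t | _] = setT)//; apply/seteqP; split.
    rewrite (_ : [set t | _] = ~` same_type H a b).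
      by apply: measurableC; exact: measurable_same_type.
    by apply/seteqP; split=> M' /=; [move=> h /h|move=> h /h].
  rewrite (_ : [set M | _] = ~` H k0 a `|` [set M : Str L | exists c,
      forall b : n.-tuple nat, same_type H a b M -> c \in b]).
    by apply: measurableU => //; exact: measurableC.
  apply/seteqP; split=> M' /= h; last by case: h.
  by have [ha|nha] := pselect (H k0 a M'); [right; exact: h|left].
have mX : measurable (chi_rooted_models F (theory F mu) x chi).
  by rewrite rootedE; exact: measurableI.
split=> //.
have FF : Filter (almost_everywhere mu) by exact: ae_filter_ringOfSetsType.
have aeT := ae_models_theory mu cF F0.
have aeR := ae_common_entry (measurable_pull (L := L)) (invariant_pull imu)
  (ergodic_pull emu) mH eH nonat.
have [N [mN N0 hN]] : {ae mu, forall M, chi_rooted_models F (theory F mu) x chi M}.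
  apply: filterS2 aeT aeR => M hT hR; rewrite rootedE; split=> // a ha.
  apply: hR => // b hb; apply: (realization_uniq ux (hT _ Thd)).
  by rewrite -ek0; apply/(hb k0).
rewrite -[X in mu X]setCK probability_setC ?(subset_measure0 _ mN hN N0) ?sube0//;
  exact: measurableC.
Qed.
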